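(* Let $\underline{A}=(A_1,\dots,A_k)\in {\rm Mat}^+_2(\mathbb{R})^k$ be a locally constant linear cocycle over a fixed Bernoulli or (primitive) Markov shift on the alphabet $\{1,\dots,k\}$, and assume that at least one component $A_i$ is singular and at least one component $A_j$ is invertible. Then either $\underline{A}$ is projectively uniformly hyperbolic, or else there is a sequence of cocycles $\underline{A}_n\in{\rm Mat}^+_2(\mathbb{R})^k$ with $\underline{A}_n\to\underline{A}$ and $L_1(\underline{A}_n)=-\infty$ for all $n\in\mathbb{N}$.
   Context: ${\rm Mat}^+_2(\mathbb{R})$ denotes the set of real $2\times 2$ matrices $g$ with $\det g\ge 0$. Let $\mathscr{A}=\{1,\dots,k\}$. The base dynamics is either a Bernoulli shift: $X=\mathscr{A}^{\mathbb{Z}}$ with product measure $\mu=p^{\mathbb{Z}}$, $p$ a probability vector with all $p_i>0$; or a Markov shift: $P=(p_{ij})$ is a primitive $k\times k$ matrix with nonnegative entries whose columns sum to $1$ ($p_{ij}$ is the probability of the transition $j\to i$, which is called admissible if $p_{ij}>0$), $q=Pq$ is the stationary probability vector, $X$ is the set of sequences $\omega\in\mathscr{A}^{\mathbb{Z}}$ with $p_{\omega_{n+1}\omega_n}>0$ for all $n$, and $\mu$ is the Markov measure with $\mu(\{\omega:\omega_{m+l}=i_l,\ 0\le l\le n\})=q_{i_0}p_{i_1i_0}\cdots p_{i_ni_{n-1}}$. In both cases $\sigma$ is the left shift $(\sigma\omega)_n=\omega_{n+1}$. A tuple $\underline A=(A_1,\dots,A_k)$ of real $2\times2$ matrices defines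 the cocycle $F(\omega,v)=(\sigma\omega,A_{\omega_1}v)$ on $X\times\mathbb{R}^2$, with iterates $A^n(\omega)=A_{\omega_n}\cdots A_{\omega_1}$; its first Lyapunov exponent is the $\mu$-a.e. constant limit $L_1(\underline A)=\lim_{n\to\infty}\frac1n\log\|A^n(\omega)\|\in[-\infty,\infty)$. The cocycle is projectively uniformly hyperbolic if there are continuous maps $\omega\mapsto E_0(\omega),E_1(\omega)$ from $X$ to one-dimensional subspaces of $\mathbb{R}^2$ with $\mathbb{R}^2=E_0(\omega)\oplus E_1(\omega)$, invariant under the cocycle ($A_{\omega_1}E_j(\omega)\subseteq E_j(\sigma\omega)$), and some $n\in\mathbb{N}$ with $\|A^n(\omega)|_{E_0(\omega)}\|<\|A^n(\omega)|_{E_1(\omega)}\|$ for all $\omega\in X$. *)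

(* Defs.v *)
From HB Require Import structures.
From mathcomp Require Import all_boot all_order all_algebra.
From mathcomp Require Import all_classical all_reals all_analysis.
From mathcomp Require Import Rstruct Rstruct_topology.
Set Implicit Arguments. Unset Strict Implicit. Unset Printing Implicit Defensive.
Import Order.TTheory GRing.Theory Num.Theory.
Local Open Scope classical_set_scope.
Local Open Scope ring_scope.

Notation R := Rdefinitions.R.

Definition seqZ (k : nat) := int -> 'I_k.

Definition shift k (w : seqZ k) : seqZ k := fun n => w (n + 1)%R.

(* --- base dynamics ---------------------------------------------------------
   P : 'M_k with P i j = probability of transition j -> i (columns sum to 1),
   q : stationary probability vector. *)
Definition prob_vector k (q : 'I_k -> R) :=
  (forall i, 0 <= q i) /\ \sum_(i < k) q i = 1.

Definition col_stochastic k (P : 'M[R]_k) :=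
  (forall i j, 0 <= P i j) /\ (forall j, \sum_(i < k) P i j = 1).

Definition primitive k (P : 'M[R]_k) :=
  exists m : nat, forall i j, 0 < (P ^+ m) i j.

(* Bernoulli shift with probability vector p (all p_i > 0), encoded as the
   Markov data with P i j = p i (all transitions admissible) and q = p. *)
Definition bernoulli_base k (P : 'M[R]_k) (q : 'I_k -> R) :=
  prob_vector q /\ (forall i, 0 < q i) /\ (forall i j, P i j = q i).

Definition markov_base k (P : 'M[R]_k) (q : 'I_k -> R) :=
  col_stochastic P /\ primitive P /\ prob_vector q /\
  (forall i, q i = \sum_(j < k) P i j * q j).

Definition shift_base k (P : 'M[R]_k) (q : 'I_k -> R) :=
  bernoulli_base P q \/ markov_base P q.

(* the phase space X: sequences all of whose transitions are admissible
   (for Bernoulli data this is the full shift). *)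
Definition inX k (P : 'M[R]_k) (w : seqZ k) := forall n : int, 0 < P (w (n + 1)%R) (w n).

Definition cylinder k (m : int) (s : seq 'I_k) : set (seqZ k) :=
  [set w | forall l : nat, (l < size s)%N -> w (m + l%:Z)%R = nth (w (m + l%:Z)%R) s l].

Fixpoint chain_mass k (P : 'M[R]_k) (i : 'I_k) (s : seq 'I_k) : R :=
  match s with
  | [::] => 1
  | j :: s' => P j i * chain_mass P j s'
  end.

Definition cyl_mass k (P : 'M[R]_k) (q : 'I_k -> R) (s : seq 'I_k) : R :=
  match s with
  | [::] => 1
  | i0 :: s' => q i0 * chain_mass P i0 s'
  end.

(* mu-null sets: sets of outer measure 0 (covers by countably many cylinders
   of arbitrarily small total mass); "mu-a.e." = outside such a set. *)
Definition mu_null k (P : 'M[R]_k) (q : 'I_k -> R) (N : set (seqZ k)) :=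
  forall eps : R, 0 < eps ->
  exists c : nat -> int * seq 'I_k,
    N `<=` \bigcup_(n in [set: nat]) cylinder (c n).1 (c n).2 /\
    forall M : nat, \sum_(n < M) cyl_mass P q (c n).2 <= eps.

Definition vnorm (v : 'cV[R]_2) : R := Num.sqrt (v 0 0 ^+ 2 + v 1 0 ^+ 2).

Definition opnorm (M : 'M[R]_2) : R :=
  sup [set vnorm (M *m v) | v in [set v : 'cV[R]_2 | vnorm v = 1]].

Definition cross (u v : 'cV[R]_2) : R := u 0 0 * v 1 0 - u 1 0 * v 0 0.

(* distance (sine of the angle) between the lines spanned by nonzero u, v *)
Definition pdist (u v : 'cV[R]_2) : R := `|cross u v| / (vnorm u * vnorm v).

Fixpoint Aiter k (A : 'I_k -> 'M[R]_2) (w : seqZ k) (n : nat) : 'M[R]_2 :=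
  match n with
  | O => 1%:M
  | n'.+1 => A (w (Posz n'.+1)) *m Aiter A w n'
  end.

Definition logE (x : R) : \bar R := if x == 0 then -oo%E else (ln x)%:E.

Definition L1_is_minfty k (P : 'M[R]_k) (q : 'I_k -> R) (A : 'I_k -> 'M[R]_2) :=
  exists N : set (seqZ k), mu_null P q N /\
    forall w, inX P w -> ~ N w ->
      (fun n : nat => ((n%:R)^-1)%:E * logE (opnorm (Aiter A w n)))%E @ \oo --> -oo%E.

(* a map w |-> line spanned by u w is continuous on X (product topology) *)
Definition line_continuous k (P : 'M[R]_k) (u : seqZ k -> 'cV[R]_2) :=
  forall w, inX P w -> forall eps : R, 0 < eps ->
  exists N : nat, forall w', inX P w' ->
    (forall i : int, `|i| <= N%:Z -> w' i = w i) -> pdist (u w) (u w') < eps.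

(* projective uniform hyperbolicity; E_j(w) = span (u_j w) *)
Definition proj_unif_hyperbolic k (P : 'M[R]_k) (A : 'I_k -> 'M[R]_2) :=
  exists u0 u1 : seqZ k -> 'cV[R]_2,
    line_continuous P u0 /\ line_continuous P u1 /\
    (forall w, inX P w -> cross (u0 w) (u1 w) != 0) /\
    (forall w, inX P w -> exists c : R, A (w 1%:Z) *m u0 w = c *: u0 (shift w)) /\
    (forall w, inX P w -> exists c : R, A (w 1%:Z) *m u1 w = c *: u1 (shift w)) /\
    exists n : nat, forall w, inX P w ->
      vnorm (Aiter A w n *m u0 w) / vnorm (u0 w) <
      vnorm (Aiter A w n *m u1 w) / vnorm (u1 w).

(* Main.v *)
Require Import Defs.
From HB Require Import structures.
From mathcomp Require Import all_boot all_order all_algebra.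
From mathcomp Require Import all_classical all_reals all_analysis.
From mathcomp Require Import Rstruct Rstruct_topology.
From mathcomp Require Import zify ring lra.
Set Implicit Arguments. Unset Strict Implicit. Unset Printing Implicit Defensive.
Import Order.TTheory GRing.Theory Num.Theory.
Import numFieldNormedType.Exports.
Local Open Scope classical_set_scope.
Local Open Scope ring_scope.

(* Perturb A to A_b rot(t), where rot(t) = 1 + tJ and J is the rotation by pi/2;
   this keeps all determinants nonnegative.  A word with zero product occurs
   almost surely, so if null words exist for arbitrarily small t then those
   perturbations have L_1 = -oo and converge to A.  Otherwise no word has zero
   product for |t| < e.  Since rotations and maps with det >= 0 move directions
   monotonically, the direction reached with position-dependent parameters
   t_1, ..., t_n in (-e, e) is also reached with a single parameter: hence no
   product with position-dependent parameters sends the range of a singular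
   letter into the kernel of a singular letter.  The scalar
   r rot(s) M rot(t) x, affine in s and in t, then vanishes nowhere on a square,
   which bounds every entry of M by |r M x| and gives
   |M_{uv}| >= c |M_u| |M_v| for all admissible words uv.  Applying one small
   rotation after the other moves a direction by a definite amount each time if
   the products stay nearly conformal, but the total motion is bounded; this
   gives n det M_u <= K |M_u|^2 for words u of length n.  These two estimates
   yield E_0 as the limit of the most contracted directions of A^n, and E_1 in
   the same way from the adjugates of the past products. *)

(** * Plane linear algebra *)

Section Plane.
Variable F : realType.
Implicit Types (M N : 'M[F]_2) (u v : 'cV[F]_2) (t : F).

Definition wedge u v : F := u 0 0 * v 1 0 - u 1 0 * v 0 0.
Definition dot u v : F := u 0 0 * v 0 0 + u 1 0 * v 1 0.
(** Not normalised: the determinant is [1 + t ^+ 2]. In exchange the entries are affine in [t]. *)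
Definition rot t : 'M[F]_2 :=
  \matrix_(i, j) if i == j then 1 else if i == 0 then - t else t.

Lemma mul2E m n (M : 'M[F]_(m, 2)) (N : 'M[F]_(2, n)) i j :
  (M *m N) i j = M i 0 * N 0 j + M i 1 * N 1 j.
Proof.
rewrite mxE big_ord_recl big_ord1; congr (_ + M i _ * N _ j); exact: val_inj.
Qed.

Lemma ord2P (i : 'I_2) : i = 0 \/ i = 1.
Proof. by case: i => [[|[|//]] ?]; [left|right]; apply/val_inj. Qed.

Lemma det2E M : \det M = M 0 0 * M 1 1 - M 0 1 * M 1 0.
Proof.
rewrite (expand_det_row _ 0) big_ord_recl big_ord1 /cofactor !det_mx11 !mxE /=.
have -> : lift (0 : 'I_2) (0 : 'I_1) = 1 by apply/val_inj.
have -> : lift (1 : 'I_2) (0 : 'I_1) = 0 by apply/val_inj.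
by rewrite /= addn0 expr0 expr1; ring.
Qed.

Lemma wedgeM M u v : wedge (M *m u) (M *m v) = \det M * wedge u v.
Proof. by rewrite /wedge !mul2E det2E; ring. Qed.

Lemma wedge_rot s t u v : wedge (rot s *m u) (rot t *m v) =
  (1 + s * t) * wedge u v + (t - s) * dot u v.
Proof. by rewrite /wedge /dot !mul2E !mxE /=; ring. Qed.

(** Submultiplicative for all shapes, so it serves rows, columns and square matrices alike. *)
Definition norm1 m n (M : 'M[F]_(m, n)) := \sum_i \sum_j `|M i j|.

Lemma norm1_ge0 m n (M : 'M[F]_(m, n)) : 0 <= norm1 M.
Proof. by apply: sumr_ge0 => i _; apply: sumr_ge0. Qed.

Lemma norm1_mul m n p (M : 'M[F]_(m, n)) (N : 'M[F]_(n, p)) :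
  norm1 (M *m N) <= norm1 M * norm1 N.
Proof.
rewrite /norm1 mulr_suml; apply: ler_sum => i _.
rewrite mulr_suml.
apply: (@le_trans _ _ (\sum_j \sum_k `|M i k| * `|N k j|)).
  apply: ler_sum => j _; rewrite mxE; apply: le_trans (ler_norm_sum _ _ _) _.
  by apply: ler_sum => k _; rewrite normrM.
rewrite exchange_big; apply: ler_sum => k _ /=.
rewrite -mulr_sumr; apply: ler_wpM2l => //.
rewrite [leRHS](bigD1 k) //= lerDl.
by apply: sumr_ge0 => l _; apply: sumr_ge0.
Qed.

Lemma norm1D m n (M N : 'M[F]_(m, n)) : norm1 (M + N) <= norm1 M + norm1 N.
Proof.
rewrite /norm1 -big_split; apply: ler_sum => i _; rewrite -big_split.
by apply: ler_sum => j _; rewrite mxE ler_normD.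
Qed.

Lemma norm1Z m n a (M : 'M[F]_(m, n)) : norm1 (a *: M) = `|a| * norm1 M.
Proof.
rewrite /norm1 mulr_sumr; apply: eq_bigr => i _; rewrite mulr_sumr.
by apply: eq_bigr => j _; rewrite mxE normrM.
Qed.

Lemma norm1_eq0 m n (M : 'M[F]_(m, n)) : (norm1 M == 0) = (M == 0).
Proof.
apply/eqP/eqP => [M0|->]; last first.
  by rewrite /norm1 big1 // => i _; rewrite big1 // => j _; rewrite mxE normr0.
apply/matrixP => i j; rewrite mxE; apply/eqP; rewrite -normr_le0 -M0 /norm1.
rewrite (bigD1 i) //= (bigD1 j) //= -addrA lerDl addr_ge0 //.
  by apply: sumr_ge0.
by apply: sumr_ge0 => k _; apply: sumr_ge0.
Qed.

Lemma norm1_0 m n : norm1 (0 : 'M[F]_(m, n)) = 0.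
Proof. by apply/eqP; rewrite norm1_eq0. Qed.

Lemma norm1_gt0 m n (M : 'M[F]_(m, n)) : (0 < norm1 M) = (M != 0).
Proof. by rewrite lt0r norm1_eq0 norm1_ge0 andbT. Qed.

Lemma norm1_col v : norm1 v = `|v 0 0| + `|v 1 0|.
Proof.
rewrite /norm1 big_ord_recl !big_ord1.
by have -> : lift (0 : 'I_2) (0 : 'I_1) = 1 by apply/val_inj.
Qed.

Lemma norm1_row (r : 'rV[F]_2) : norm1 r = `|r 0 0| + `|r 0 1|.
Proof.
rewrite /norm1 big_ord1 big_ord_recl !big_ord1.
by have -> : lift (0 : 'I_2) (0 : 'I_1) = 1 by apply/val_inj.
Qed.

Lemma norm1_sq M : norm1 M = `|M 0 0| + `|M 0 1| + `|M 1 0| + `|M 1 1|.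
Proof.
rewrite /norm1 !big_ord_recl !big_ord0 !addr0 /=.
have -> : lift (0 : 'I_2) (0 : 'I_1) = 1 by apply/val_inj.
by rewrite !addrA.
Qed.

Lemma norm1_11 (a : 'M[F]_1) : norm1 a = `|a 0 0|.
Proof. by rewrite /norm1 !big_ord1. Qed.

Lemma adj2E M :
  \adj M = \matrix_(i, j) if i == j then M (1 - i) (1 - i) else - M i j.
Proof.
have l0 : lift (0 : 'I_2) (0 : 'I_1) = 1 by apply/val_inj.
have l1 : lift (1 : 'I_2) (0 : 'I_1) = 0 by apply/val_inj.
have e0 : (1 - 0 : 'I_2) = 1 by apply/val_inj.
have e1 : (1 - 1 : 'I_2) = 0 by apply/val_inj.
apply/matrixP => i j; case: (ord2P i) => ->; case: (ord2P j) => ->;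
  rewrite !mxE /= /cofactor det_mx11 !mxE ?l0 ?l1 ?e0 ?e1 /= ?expr2 ?expr1 ?expr0; ring.
Qed.

Lemma norm1_adj2 M : norm1 (\adj M) = norm1 M.
Proof.
rewrite !norm1_sq adj2E !mxE /= !normrN.
have -> : (1 - 0 : 'I_2) = 1 by apply/val_inj.
have -> : (1 - 1 : 'I_2) = 0 by apply/val_inj.
by ring.
Qed.

Lemma adj2M M N : \adj (M *m N) = \adj N *m \adj M.
Proof.
have e0 : (1 - 0 : 'I_2) = 1 by apply/val_inj.
have e1 : (1 - 1 : 'I_2) = 0 by apply/val_inj.
rewrite !adj2E; apply/matrixP => i j; case: (ord2P i) => ->; case: (ord2P j) => ->;
  by rewrite !(mul2E, mxE) /= ?e0 ?e1; ring.
Qed.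

Lemma det_adj2 M : \det (\adj M) = \det M.
Proof.
rewrite !det2E adj2E !mxE /=.
have -> : (1 - 0 : 'I_2) = 1 by apply/val_inj.
have -> : (1 - 1 : 'I_2) = 0 by apply/val_inj.
by ring.
Qed.

Lemma det_le_norm1 M : `|\det M| <= norm1 M ^+ 2.
Proof.
rewrite det2E norm1_sq; apply: le_trans (ler_normB _ _) _; rewrite !normrM.
move: (normr_ge0 (M 0 0)) (normr_ge0 (M 0 1)) (normr_ge0 (M 1 0)) (normr_ge0 (M 1 1)).
by nra.
Qed.

(** One row is a multiple of the other. For a singular letter, [r] yields the range and [l] the
    kernel. *)
Lemma rank1_fact M : \det M = 0 -> exists (r : 'cV[F]_2) (l : 'rV[F]_2), M = r *m l.
Proof.
rewrite det2E => d0.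
have [[h0 h1]|/eqP h] : (M 0 0 = 0 /\ M 0 1 = 0) \/ ((M 0 0, M 0 1) != (0, 0)).
- by case: eqP => [[-> ->]|]; [left|right].
- exists (delta_mx 1 0), (row 1 M); apply/matrixP => i j.
  rewrite mxE big_ord1 !mxE; case: (ord2P i) => ->; case: (ord2P j) => ->;
  by rewrite /= ?mul1r ?mul0r.
have [a0|a0] := eqVneq (M 0 0) 0; last first.
  exists (\col_i (if i == 0 then 1 else M 1 0 / M 0 0)), (row 0 M).
  apply/matrixP => i j.
  rewrite mxE big_ord1 !mxE; case: (ord2P i) => ->; case: (ord2P j) => -> /=;
    rewrite ?mul1r //; first by field.
  have -> : M 1 1 = M 0 1 * M 1 0 / M 0 0.
    by apply: (mulIf a0); rewrite mulfVK //; lra.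
  by field.
have b0 : M 0 1 != 0 by apply/eqP => b0; apply: h; rewrite a0 b0.
exists (\col_i (if i == 0 then 1 else M 1 1 / M 0 1)), (row 0 M).
apply/matrixP => i j.
rewrite mxE big_ord1 !mxE; case: (ord2P i) => ->; case: (ord2P j) => -> /=;
  rewrite ?mul1r //; last by field.
have -> : M 1 0 = M 0 0 * M 1 1 / M 0 1.
  by apply: (mulIf b0); rewrite mulfVK //; lra.
by field.
Qed.
End Plane.

(** * Turning curves and position-dependent perturbations *)

Section Turning.
Variable F : realType.
Implicit Types (M N : 'M[F]_2) (u v : 'cV[F]_2) (t : F).

(** The zeros of [p] between [a] and [b] form a nonempty compact set, on which the distance to [b]
    attains its minimum. *)
Lemma closest_zero (p : F -> F) a b : continuous p -> p a = 0 ->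
  exists z, [/\ Num.min a b <= z <= Num.max a b, p z = 0 &
    forall x, Num.min a b <= x <= Num.max a b -> p x = 0 -> `|z - b| <= `|x - b|].
Proof.
move=> cp pa.
set S := `[Num.min a b, Num.max a b] `&` p @^-1` [set 0].
have cS : compact S.
  apply: subclosed_compact (@segment_compact F (Num.min a b) (Num.max a b)) _;
    last by move=> x [].
  apply: closedI; first exact: itv_closed.
  by apply: preimage_closed => //; apply: closed_eq.
have S0 : S !=set0.
  by exists a; split => //=; rewrite in_itv /= ge_min le_max lexx.
have cf : {within S, continuous (fun x : F => `|x - b|)}.
  apply: continuous_subspaceT => x.
  apply: (@continuous_comp _ _ _ (fun x => x - b) (fun y => `|y|)); last exact: norm_continuous.
  by apply: continuousB; [exact: cvg_id | exact: cvg_cst].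
have [z + zmin] := compact_EVT_min S0 cS cf.
rewrite inE => -[]; rewrite /= in_itv /= => zab pz.
exists z; split => // x xab px; apply: zmin; rewrite inE; split => //=.
Qed.

Lemma IVT0 (p : F -> F) a b : continuous p -> p a * p b <= 0 ->
  exists z, Num.min a b <= z <= Num.max a b /\ p z = 0.
Proof.
move=> cp pab.
wlog ab : a b pab / a <= b => [H|].
  case: (leP a b) => ab.
    by have := H a b pab ab; rewrite (min_l ab) (max_r ab).
  have [|z] := H b a _ (ltW ab); first by rewrite mulrC.
  by rewrite minC maxC => zP; exists z; move: zP; rewrite (min_r (ltW ab)) (max_l (ltW ab)).
have [||z zab pz] := @IVT F p a b 0 ab; first exact: continuous_subspaceT.
  rewrite ge_min le_max; case: (leP (p a) 0) => pa; case: (leP (p b) 0) => pb //=; nra.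
by exists z; split => //; rewrite (min_l ab) (max_r ab); move: zab; rewrite in_itv.
Qed.

(* [q a a / |g a|^2] is the angular speed of [g] at [a]; under the second
   alternative of [turn_pos] the direction of [g] turns counterclockwise, under
   the first one it is constant. *)
Record turning (e : F) (g : F -> 'cV[F]_2) (q : F -> F -> F) : Prop := Turning {
  turn_eq : forall a b, wedge (g a) (g b) = (b - a) * q a b;
  turn_cq : forall a, continuous (q a);
  turn_cg : forall i, continuous (fun t => g t i 0);
  turn_pos : (forall a b, q a b = 0) \/ (forall a, `|a| < e -> 0 < q a a) }.

Lemma turning_cst e v : turning e (fun=> v) (fun _ _ => 0).
Proof.
split; [by move=> a b; rewrite /wedge; ring | | | by left].
  by move=> a x; exact: cvg_cst.
by move=> i x; exact: cvg_cst.
Qed.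

Lemma dot_gt0 v : v != 0 -> 0 < dot v v.
Proof.
move=> v0; rewrite lt_neqAle eq_sym /dot -!expr2 addr_ge0 ?sqr_ge0 // andbT.
apply: contra v0; rewrite paddr_eq0 ?sqr_ge0 // !sqrf_eq0 => /andP[/eqP a /eqP b].
by apply/eqP/matrixP => i j; rewrite (ord1 j) mxE; case: (ord2P i) => ->.
Qed.

(** Rotating by [rot t] adds the positive term [dot (g t) (g t)] to the angular speed, and [M]
    multiplies wedges by [\det M]. If [M] is singular, the new direction is constant. *)
Lemma turning_step e g q M : 0 <= \det M -> (forall t, `|t| < e -> g t != 0) ->
  turning e g q -> turning e (fun t => (M *m rot t) *m g t)
    (fun a b => \det M * ((1 + a * b) * q a b + dot (g a) (g b))).
Proof.
move=> dM g0 [qE cq cg qpos].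
have crg i : continuous (fun t => (rot t *m g t) i 0).
  move=> x; have E : (fun t => (rot t *m g t) i 0) =
    (fun t => if i == 0 then g t 0 0 - t * g t 1 0 else t * g t 0 0 + g t 1 0).
    by apply/funext => t; rewrite mul2E !mxE; case: (ord2P i) => -> /=; ring.
  rewrite E; case: (i == 0).
    by apply: cvgB; [exact: cg|apply: cvgM; [exact: cvg_id|exact: cg]].
  by apply: cvgD; [apply: cvgM; [exact: cvg_id|exact: cg]|exact: cg].
split.
- by move=> a b; rewrite -!mulmxA wedgeM wedge_rot qE; ring.
- move=> a x; apply: cvgM; first exact: cvg_cst.
  apply: cvgD.
    apply: cvgM; last exact: cq.
    apply: cvgD; first exact: cvg_cst.
    by apply: cvgM; [exact: cvg_cst|exact: cvg_id].
  by apply: cvgD; (apply: cvgM; [exact: cvg_cst|exact: cg]).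
- move=> i x.
  have -> : (fun t => (M *m rot t *m g t) i 0) =
    (fun t => M i 0 * (rot t *m g t) 0 0 + M i 1 * (rot t *m g t) 1 0).
    by apply/funext => t; rewrite -mulmxA mul2E.
  by apply: cvgD; (apply: cvgM; [exact: cvg_cst|exact: crg]).
have [d0|d0] := eqVneq (\det M) 0; first by left => a b; rewrite d0 mul0r.
right => a ae; apply: mulr_gt0; first by rewrite lt0r d0.
have := dot_gt0 (g0 _ ae).
case: qpos => [q0 ?|/(_ _ ae) qa]; first by rewrite q0 mulr0 add0r.
by move: qa; nra.
Qed.

Lemma wedge0_par u v : u != 0 -> wedge u v = 0 -> exists c, v = c *: u.
Proof.
move=> u0 uv; exists (dot u v / dot u u); have := dot_gt0 u0 => d0.
have dn : dot u u != 0 by rewrite gt_eqF.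
apply/matrixP => i j; rewrite (ord1 j) mxE; apply: (mulIf dn).
rewrite mulrAC mulfVK //; apply/eqP; rewrite -subr_eq0; apply/eqP.
case: (ord2P i) => ->.
  transitivity (- u 1 0 * wedge u v); last by rewrite uv mulr0.
  by rewrite /wedge /dot; ring.
transitivity (u 0 0 * wedge u v); last by rewrite uv mulr0.
by rewrite /wedge /dot; ring.
Qed.

Lemma wedgeZl c u v : wedge (c *: u) v = c * wedge u v.
Proof. by rewrite /wedge !mxE; ring. Qed.

(* Let z be the point closest to s at which g has the direction g t'.  Between z
   and s the curve does not return to this direction, so that the wedge of
   rot s (g z) with rot t (g t) has opposite signs at t = z and t = s. *)
Lemma turning_catch e g q t' s : (forall t, `|t| < e -> g t != 0) ->
  turning e g q -> `|t'| < e -> `|s| < e ->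
  exists t, `|t| < e /\ wedge (rot s *m g t') (rot t *m g t) = 0.
Proof.
move=> g0 tg t'e se; have [qE cq cg qpos] := tg.
case: qpos => [q0|qpos].
  by exists s; split => //; rewrite wedge_rot qE q0; ring.
have cw u : continuous (fun t => wedge u (g t)).
  move=> x; rewrite /wedge; apply: cvgB;
  by apply: cvgM; [exact: cvg_cst|exact: cg].
have [|z [zts wz zmin]] := @closest_zero (fun t => wedge (g t') (g t)) t' s (cw _).
  by rewrite /wedge; ring.
have inside x : Num.min t' s <= x <= Num.max t' s -> `|x| < e.
  move: t'e se; rewrite !ltr_norml ge_min le_max.
  by move=> /andP[? ?] /andP[? ?] /andP[/orP[?|?] /orP[?|?]]; apply/andP; split; lra.
have ze := inside z zts.
have [c gz] := wedge0_par (g0 _ t'e) wz.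
have c0 : c != 0 by apply/eqP => c0; move: (g0 _ ze); rewrite gz c0 scale0r eqxx.
suff [t [te wt]] : exists t, `|t| < e /\ wedge (rot s *m g z) (rot t *m g t) = 0.
  exists t; split => //; apply/eqP; move: wt.
  by rewrite gz -scalemxAr wedgeZl => /eqP; rewrite mulf_eq0 (negbTE c0).
have [->|zs] := eqVneq z s.
  by exists s; split => //; rewrite /wedge; ring.
have zsin x : Num.min z s <= x <= Num.max z s -> Num.min t' s <= x <= Num.max t' s.
  move: zts; case: (leP t' s) => ?; case: (leP z s) => ? /andP[? ?] /andP[? ?];
  by apply/andP; split; lra.
(* Otherwise [q z], positive at [z], vanishes at some [x] between [z] and [s]. There [g x] is
   parallel to [g z], and [x] is closer to [s] than [z] is. *)
have qs : 0 < q z s.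
  rewrite ltNge; apply/negP => qs.
  have [|x [xin qx]] := @IVT0 (q z) z s (cq z).
    by rewrite pmulr_rle0 // qpos.
  have xz : x != z by apply/eqP => xz; move: (qpos _ ze); rewrite -{2}xz qx ltxx.
  have wx : wedge (g t') (g x) = 0.
    have : wedge (g z) (g x) = 0 by rewrite qE qx mulr0.
    by rewrite gz wedgeZl => /eqP; rewrite mulf_eq0 (negbTE c0) => /eqP.
  have := zmin x (zsin _ xin) wx.
  move: xin; case: (leP z s) => zs' /andP[x1 x2].
    rewrite !ler0_norm ?subr_le0 // lerN2 lerD2r => xz'.
    by move/eqP: xz; apply; apply/eqP; rewrite eq_le xz'.
  rewrite !ger0_norm ?subr_ge0 //; last exact: ltW.
  rewrite lerD2r => xz'.
  by move/eqP: xz; apply; apply/eqP; rewrite eq_le xz' andbT.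
have [||t [tin wt]] := @IVT0 (fun t => wedge (rot s *m g z) (rot t *m g t)) z s.
- move=> x; under eq_fun do rewrite wedge_rot.
  apply: cvgD; apply: cvgM.
  + by apply: cvgD; [exact: cvg_cst|apply: cvgM; [exact: cvg_cst|exact: cvg_id]].
  + exact: cw.
  + by apply: cvgB; [exact: cvg_id|exact: cvg_cst].
  + by apply: cvgD; (apply: cvgM; [exact: cvg_cst|exact: cg]).
- have wzz : wedge (g z) (g z) = 0 by rewrite /wedge; ring.
  rewrite !wedge_rot wzz qE.
  rewrite subrr mul0r mulr0 add0r addr0.
  have -> : (z - s) * dot (g z) (g z) * ((1 + s * s) * ((s - z) * q z s)) =
    - ((s - z) ^+ 2 * dot (g z) (g z) * (1 + s ^+ 2) * q z s) by ring.
  have d0 := ltW (dot_gt0 (g0 _ ze)); have q0 := ltW qs.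
  have h1 : 0 <= 1 + s ^+ 2 by rewrite addr_ge0 ?sqr_ge0.
  by rewrite oppr_le0 (mulr_ge0 (mulr_ge0 (mulr_ge0 (sqr_ge0 _) d0) h1) q0).
by exists t; split => //; apply/inside/zsin.
Qed.

(* later letters act on the left *)
Fixpoint mprod (l : seq 'M[F]_2) : 'M[F]_2 :=
  if l is M :: l' then mprod l' *m M else 1%:M.

Lemma mprod_cat l1 l2 : mprod (l1 ++ l2) = mprod l2 *m mprod l1.
Proof. by elim: l1 => [|M l1 IH] /=; rewrite ?mulmx1 // IH mulmxA. Qed.

Lemma mprod_rcons l M : mprod (rcons l M) = M *m mprod l.
Proof. by rewrite -cats1 mprod_cat /= mul1mx. Qed.

(** Induction on the word from its end, carrying along that the uniform family is turning and
    attains the direction of the nonuniform product at some parameter. [turning_catch] passes this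
    on to the next letter; if the nonuniform product vanished there, so would the uniform one at the
    parameter caught. *)
Lemma nonuniform_perturbation e (r : 'cV[F]_2) (xs : seq ('M[F]_2 * F)) : 0 < e ->
  (forall x, x \in xs -> 0 <= \det x.1 /\ `|x.2| < e) ->
  (forall t, `|t| < e -> mprod [seq x.1 *m rot t | x <- xs] *m r != 0) ->
  mprod [seq x.1 *m rot x.2 | x <- xs] *m r != 0.
Proof.
move=> e0 xsP unif.
suff [] : (exists q, turning e (fun t => mprod [seq x.1 *m rot t | x <- xs] *m r) q) /\
  (mprod [seq x.1 *m rot x.2 | x <- xs] *m r != 0 /\
   exists t, `|t| < e /\ wedge (mprod [seq x.1 *m rot x.2 | x <- xs] *m r)
     (mprod [seq x.1 *m rot t | x <- xs] *m r) = 0) by move=> _ [].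
elim/last_ind: xs xsP unif => [|xs [M s] IH] xsP unif /=.
  have r0 : r != 0 by have := unif 0; rewrite normr0 /= mul1mx; apply.
  split; first by exists (fun _ _ => 0); under eq_fun do rewrite mul1mx; exact: turning_cst.
  split; first by rewrite mul1mx.
  by exists 0; rewrite normr0 e0 mul1mx /wedge; split => //; ring.
have [dM se] := xsP (M, s) ltac:(by rewrite mem_rcons mem_head).
have unif' t : `|t| < e -> mprod [seq x.1 *m rot t | x <- xs] *m r != 0.
  move=> te; apply/eqP => E; move: (unif t te).
  by rewrite map_rcons mprod_rcons -mulmxA E mulmx0 eqxx.
have [|[q tq] [v0 [t' [t'e wt']]]] := IH _ unif'.
  by move=> x xin; apply: xsP; rewrite mem_rcons inE xin orbT.
have E t : mprod [seq x.1 *m rot t | x <- rcons xs (M, s)] *m r =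
  (M *m rot t) *m (mprod [seq x.1 *m rot t | x <- xs] *m r).
  by rewrite map_rcons mprod_rcons mulmxA.
split.
  exists (fun a b => \det M * ((1 + a * b) * q a b + dot (mprod [seq x.1 *m rot a | x <- xs] *m r)
     (mprod [seq x.1 *m rot b | x <- xs] *m r))).
  by rewrite (eq_fun E); apply: turning_step.
rewrite map_rcons mprod_rcons -mulmxA /=.
set v := mprod _ *m r in v0 wt' *.
have [t [te wt]] := turning_catch unif' tq t'e se.
have w3 : wedge (rot s *m v) (rot t *m (mprod [seq x.1 *m rot t | x <- xs] *m r)) = 0.
  have [c cE] := wedge0_par v0 wt'.
  move: wt; rewrite cE -scalemxAr wedgeZl => /eqP; rewrite mulf_eq0 => /orP[/eqP c0|/eqP //].
  by move: (unif' _ t'e); rewrite cE c0 scale0r eqxx.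
split; last first.
  by exists t; split => //; rewrite E -!mulmxA wedgeM w3 mulr0.
have rs0 : rot s *m v != 0.
  apply/eqP => rs; have : rot (- s) *m (rot s *m v) = (1 + s ^+ 2) *: v.
    apply/matrixP => i j; rewrite (ord1 j) !(mul2E, mxE) /=.
    by case: (ord2P i) => -> /=; ring.
  rewrite rs mulmx0 => /eqP; rewrite eq_sym scaler_eq0 (negbTE v0) orbF gt_eqF //.
  by rewrite ltr_pwDl ?sqr_ge0.
have [c cE] := wedge0_par rs0 w3.
apply/eqP => Mv; move: (unif t te).
by rewrite E -!mulmxA cE -scalemxAr [M *m (_ *m v)]mulmxA Mv scaler0 eqxx.
Qed.
End Turning.

(** * Separation from kernels *)

Section Separation.
Variable F : realType.
Implicit Types (M N : 'M[F]_2) (x : 'cV[F]_2) (r : 'rV[F]_2) (t e : F).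

(** If [q != 0], the root [- p / q] has to lie outside the interval. *)
Lemma affine_nonzero e (p q : F) : (forall t, `|t| < e -> p + q * t != 0) ->
  e * `|q| <= `|p|.
Proof.
move=> H; rewrite leNgt; apply/negP => pq.
have [q0|q0] := eqVneq q 0; first by move: pq; rewrite q0 normr0 mulr0 ltNge normr_ge0.
have /H : `|- p / q| < e by rewrite normrM normrN normfV ltr_pdivrMr ?normr_gt0.
by rewrite mulrC mulfVK // subrr eqxx.
Qed.

Definition J : 'M[F]_2 := rot 1 - 1%:M.

Lemma rotJ t : rot t = 1%:M + t *: J.
Proof.
apply/matrixP => i j; rewrite !mxE.
by case: (ord2P i) => ->; case: (ord2P j) => -> /=; rewrite ?mulr1n ?mulr0n; ring.
Qed.

Definition ev r M x : F := (r *m M *m x) 0 0.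

Lemma evE r M x : ev r M x =
  (r 0 0 * M 0 0 + r 0 1 * M 1 0) * x 0 0 + (r 0 0 * M 0 1 + r 0 1 * M 1 1) * x 1 0.
Proof. by rewrite /ev !mul2E. Qed.

Lemma evDr r M N x : ev r (M + N) x = ev r M x + ev r N x.
Proof. by rewrite !evE !mxE; ring. Qed.

Lemma evZ r a M x : ev r (a *: M) x = a * ev r M x.
Proof. by rewrite !evE !mxE; ring. Qed.

Lemma ev_le r M x : `|ev r M x| <= norm1 r * norm1 M * norm1 x.
Proof.
rewrite /ev -norm1_11; apply: le_trans (norm1_mul _ _) _.
by rewrite ler_wpM2r ?norm1_ge0 // norm1_mul.
Qed.

Lemma norm1_col_sqr x : norm1 x ^+ 2 <= 2 * (x 0 0 ^+ 2 + x 1 0 ^+ 2).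
Proof.
rewrite norm1_col -(real_normK (num_real (x 0 0))) -(real_normK (num_real (x 1 0))).
by have := sqr_ge0 (`|x 0 0| - `|x 1 0|); nra.
Qed.

Lemma norm1_row_sqr r : norm1 r ^+ 2 <= 2 * (r 0 0 ^+ 2 + r 0 1 ^+ 2).
Proof.
rewrite norm1_row -(real_normK (num_real (r 0 0))) -(real_normK (num_real (r 0 1))).
by have := sqr_ge0 (`|r 0 0| - `|r 0 1|); nra.
Qed.

(** [r] and [x], together with their quarter turns, form orthogonal bases, so each entry of [M] is a
    combination of these four values. The constant 16 is 4 for the number of entries times 4 for
    comparing [norm1] with Euclidean norms. *)
Lemma norm1_le_ev r M x : norm1 r * norm1 M * norm1 x <=
  16 * (`|ev r M x| + `|ev r (M *m J) x| + `|ev r (J *m M) x| + `|ev r (J *m M *m J) x|).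
Proof.
have [->|r0] := eqVneq r 0.
  by rewrite norm1_0 !mul0r mulr_ge0 ?addr_ge0.
have [->|x0] := eqVneq x 0.
  by rewrite norm1_0 mulr0 mulr_ge0 ?addr_ge0.
set a := ev r M x; set b := ev r _ x; set c := ev r _ x; set d := ev r _ x.
set S := `|a| + `|b| + `|c| + `|d|.
set R2 := r 0 0 ^+ 2 + r 0 1 ^+ 2; set X2 := x 0 0 ^+ 2 + x 1 0 ^+ 2.
have R0 : 0 <= R2 by rewrite addr_ge0 ?sqr_ge0.
have X0 : 0 <= X2 by rewrite addr_ge0 ?sqr_ge0.
have comb (p q y z : F) : `|p| <= norm1 r -> `|q| <= norm1 r -> `|y| <= norm1 x -> `|z| <= norm1 x ->
    `|p * a * y + p * b * z + q * c * y + q * d * z| <= S * (norm1 r * norm1 x).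
  move=> p1 q1 y1 z1; rewrite /S !mulrDl.
  apply: le_trans (ler_normD _ _) _; apply: lerD.
    apply: le_trans (ler_normD _ _) _; apply: lerD.
      apply: le_trans (ler_normD _ _) _; apply: lerD.
        by rewrite !normrM [`|p| * _]mulrC -mulrA ler_wpM2l // ler_pM.
      by rewrite !normrM [`|p| * _]mulrC -mulrA ler_wpM2l // ler_pM.
    by rewrite !normrM [`|q| * _]mulrC -mulrA ler_wpM2l // ler_pM.
  by rewrite !normrM [`|q| * _]mulrC -mulrA ler_wpM2l // ler_pM.
have r1 : `|r 0 0| <= norm1 r by rewrite norm1_row lerDl.
have r2 : `|r 0 1| <= norm1 r by rewrite norm1_row lerDr.
have x1 : `|x 0 0| <= norm1 x by rewrite norm1_col lerDl.
have x2 : `|x 1 0| <= norm1 x by rewrite norm1_col lerDr.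
have bnd i j : `|M i j| * (R2 * X2) <= S * (norm1 r * norm1 x).
  rewrite -[R2 * X2]ger0_norm ?mulr_ge0 // -normrM.
  have E : M i j * (R2 * X2) =
     (if i == 0 then r 0 0 else r 0 1) * a * (if j == 0 then x 0 0 else x 1 0) +
     (if i == 0 then r 0 0 else r 0 1) * b * (if j == 0 then - x 1 0 else x 0 0) +
     (if i == 0 then r 0 1 else - r 0 0) * c * (if j == 0 then x 0 0 else x 1 0) +
     (if i == 0 then r 0 1 else - r 0 0) * d * (if j == 0 then - x 1 0 else x 0 0).
    rewrite /a /b /c /d !evE !(mul2E, mxE) /= /R2 /X2 ?mulr1n ?mulr0n.
    by case: (ord2P i) => ->; case: (ord2P j) => -> /=; ring.
  by rewrite E; apply: comb; case: (_ == 0); rewrite ?normrN.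
have tot : norm1 M * (R2 * X2) <= 4 * (S * (norm1 r * norm1 x)).
  move: (bnd 0 0) (bnd 0 1) (bnd 1 0) (bnd 1 1); rewrite norm1_sq.
  by move: (R2 * X2) (S * _) => y z; lra.
have rp : 0 < norm1 r by rewrite norm1_gt0.
have xp : 0 < norm1 x by rewrite norm1_gt0.
rewrite -(ler_pM2r (mulr_gt0 rp xp)).
have := norm1_col_sqr x; have := norm1_row_sqr r; rewrite -/R2 -/X2 => rr xx.
have rx : norm1 r ^+ 2 * norm1 x ^+ 2 <= 4 * (R2 * X2).
  have -> : 4 * (R2 * X2) = (2 * R2) * (2 * X2) by ring.
  by rewrite ler_pM ?sqr_ge0.
have -> : norm1 r * norm1 M * norm1 x * (norm1 r * norm1 x) = norm1 M * (norm1 r ^+ 2 * norm1 x ^+ 2) by ring.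
apply: le_trans (_ : norm1 M * (4 * (R2 * X2)) <= _); first by rewrite ler_wpM2l ?norm1_ge0.
by move: tot; lra.
Qed.

(** The value is [(a + b * t) + (c + d * t) * s], and [affine_nonzero] applies in each variable. It
    bounds [b] and [c] directly, and [d] through the difference of [c + d * t] at [t = e / 2] and
    [t = - (e / 2)]. After scaling by [e ^+ 2] the four terms cost at most 1, 1, 1 and 3 times
    [|a|], whence 96 = 16 * 6. *)
Lemma nonzero_square_bound e r M x : 0 < e -> e <= 1 ->
  (forall s t, `|s| < e -> `|t| < e -> ev r (rot s *m M *m rot t) x != 0) ->
  e ^+ 2 * (norm1 r * norm1 M * norm1 x) <= 96 * `|ev r M x|.
Proof.
move=> e0 e1 H.
have E s t : ev r (rot s *m M *m rot t) x =
  (ev r M x + ev r (M *m J) x * t) + (ev r (J *m M) x + ev r (J *m M *m J) x * t) * s.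
  by rewrite !rotJ !evE !(mul2E, mxE) /= ?mulr1n ?mulr0n; ring.
have := norm1_le_ev r M x.
move: E; set a := ev r M x; set b := ev r _ x; set c := ev r _ x; set d := ev r _ x => E.
set T := norm1 r * norm1 M * norm1 x => TS.
have hb : e * `|b| <= `|a|.
  apply: affine_nonzero => t te; have := H 0 t.
  by rewrite E normr0 mulr0 addr0; apply.
have hc t : `|t| < e -> e * `|c + d * t| <= `|a + b * t|.
  by move=> te; apply: affine_nonzero => s se; rewrite -E H.
have c1 : e * `|c| <= `|a| by have := hc 0; rewrite normr0 !mulr0 !addr0; apply.
have e2 : `|e / 2| < e by rewrite gtr0_norm; lra.
have := hc _ e2; have := hc (- (e / 2)); rewrite normrN => /(_ e2) d1 d2.
have b1 : `|a + b * (e / 2)| <= 3 / 2 * `|a|.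
  apply: le_trans (ler_normD _ _) _; rewrite normrM (gtr0_norm (_ : 0 < e / 2)); last by lra.
  by move: hb; lra.
have b2 : `|a + b * - (e / 2)| <= 3 / 2 * `|a|.
  apply: le_trans (ler_normD _ _) _; rewrite normrM normrN (gtr0_norm (_ : 0 < e / 2)); last by lra.
  by move: hb; lra.
have dd : e ^+ 2 * `|d| <= 3 * `|a|.
  have -> : e ^+ 2 * `|d| = e * `|(c + d * (e / 2)) - (c + d * - (e / 2))|.
    have -> : (c + d * (e / 2)) - (c + d * - (e / 2)) = e * d by lra.
    by rewrite normrM (gtr0_norm e0); ring.
  apply: le_trans (_ : e * (`|c + d * (e / 2)| + `|c + d * - (e / 2)|) <= _).
    by rewrite ler_wpM2l ?(ltW e0) // ler_normB.
  by rewrite mulrDr; lra.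
have ee y : 0 <= y -> e ^+ 2 * y <= e * y.
  by move=> y0; rewrite expr2 -mulrA ler_wpM2l ?(ltW e0) // ler_piMl.
have aa : e ^+ 2 * `|a| <= `|a| by rewrite -[leRHS]mul1r ler_wpM2r // expr_le1 // ltW.
have bb := le_trans (ee _ (normr_ge0 b)) hb.
have cc := le_trans (ee _ (normr_ge0 c)) c1.
have : e ^+ 2 * T <= e ^+ 2 * (16 * (`|a| + `|b| + `|c| + `|d|)).
  by rewrite ler_wpM2l // sqr_ge0.
by rewrite mulrCA !mulrDr; lra.
Qed.

(* cotangent of the angle between [M *m x] and the kernel of [r] *)
Definition cotg r M x : F := ev r (J *m M) x / ev r M x.

(** The difference of the cotangents is [t] times [\det M] times the squared Euclidean norms of [r]
    and [x], over the product of the two values of [ev]. These values have the same sign, because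
    [ev] does not vanish in between, and their product is bounded through the norm of [M]. *)
Lemma cotg_step e kap t r M x : 0 < t -> t < e -> e <= 1 -> 0 <= kap ->
  (forall s, `|s| < e -> ev r (M *m rot s) x != 0) ->
  kap * norm1 M ^+ 2 <= \det M ->
  t * kap / 8 <= cotg r M x - cotg r M (rot t *m x).
Proof.
move=> t0 te e1 k0 H kM.
have E N s : ev r (N *m rot s) x = ev r N x + ev r (N *m J) x * s.
  by rewrite rotJ mulmxDr mulmx1 -scalemxAr evDr evZ mulrC.
have ass N s : ev r N (rot s *m x) = ev r (N *m rot s) x by rewrite /ev !mulmxA.
have aff : e * `|ev r (M *m J) x| <= `|ev r M x|.
  by apply: affine_nonzero => s se; rewrite -E H.
rewrite /cotg !ass !E.
have c0 : ev r M x != 0.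
  by have := H 0; rewrite E mulr0 addr0 normr0; apply; lra.
have ct0 : ev r M x + ev r (M *m J) x * t != 0.
  by rewrite -E; apply: H; rewrite gtr0_norm.
have up : ev r M x * (ev r M x + ev r (M *m J) x * t) <= 2 * (norm1 r * norm1 M * norm1 x) ^+ 2.
  have le1 := ev_le r M x.
  have le2 : `|ev r M x + ev r (M *m J) x * t| <= 2 * `|ev r M x|.
    apply: le_trans (ler_normD _ _) _; rewrite normrM (gtr0_norm t0).
    by have := normr_ge0 (ev r (M *m J) x); nra.
  apply: le_trans (ler_norm _) _; rewrite normrM.
  apply: le_trans (_ : `|ev r M x| * (2 * `|ev r M x|) <= _); first by rewrite ler_wpM2l.
  rewrite mulrCA ler_wpM2l // -expr2.
  by rewrite ler_sqr ?nnegrE // (le_trans _ le1).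
have pos : 0 < ev r M x * (ev r M x + ev r (M *m J) x * t).
  rewrite lt0r mulf_neq0 //= mulrDr -expr2.
  set b := ev r (M *m J) x in aff *; set a := ev r M x in aff *.
  have : - (a * (b * t)) <= a ^+ 2.
    rewrite -(real_normK (num_real a)) expr2.
    apply: le_trans (ler_norm _) _; rewrite normrN !normrM (gtr0_norm t0).
    by rewrite ler_wpM2l //; have := normr_ge0 b; nra.
  by lra.
set c := ev r M x in c0 ct0 up pos *; set c1 := ev r (M *m J) x in ct0 up pos *.
set d := ev r _ x; set d1 := ev r _ x.
set R2 := r 0 0 ^+ 2 + r 0 1 ^+ 2; set X2 := x 0 0 ^+ 2 + x 1 0 ^+ 2.
have det : d * c1 - d1 * c = R2 * X2 * \det M.
  rewrite /d /d1 /c /c1 !evE !(mul2E, mxE) /= det2E /R2 /X2 ?mulr1n ?mulr0n; ring.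
have -> : d / c - (d + d1 * t) / (c + c1 * t) = t * (d * c1 - d1 * c) / (c * (c + c1 * t)).
  by field; apply/andP; split.
rewrite det ler_pdivlMr //.
apply: le_trans (_ : t * kap / 8 * (2 * (norm1 r * norm1 M * norm1 x) ^+ 2) <= _).
  by rewrite ler_wpM2l // divr_ge0 // mulr_ge0 // ltW.
have rx : norm1 r ^+ 2 * norm1 x ^+ 2 <= 4 * (R2 * X2).
  have -> : 4 * (R2 * X2) = (2 * R2) * (2 * X2) by ring.
  by rewrite ler_pM ?sqr_ge0 ?norm1_row_sqr ?norm1_col_sqr.
have -> : t * kap / 8 * (2 * (norm1 r * norm1 M * norm1 x) ^+ 2) =
  t / 4 * ((norm1 r ^+ 2 * norm1 x ^+ 2) * (kap * norm1 M ^+ 2)) by field.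
have -> : t * (R2 * X2 * \det M) = t / 4 * (4 * (R2 * X2) * \det M) by field.
rewrite ler_wpM2l; [|by rewrite divr_ge0 // ltW|].
  by [].
rewrite ler_pM //; first by rewrite mulr_ge0 ?sqr_ge0.
by rewrite mulr_ge0 ?sqr_ge0.
Qed.

(** Each letter is preceded by its own rotation, and [rot s] follows the last one, so that a
    nonempty product can be rotated independently at both ends. *)
Definition robust e r x (l : seq 'M[F]_2) := forall xs s,
  map fst xs = l -> (forall y, y \in xs -> `|y.2| < e) -> `|s| < e ->
  ev r (rot s *m mprod [seq y.1 *m rot y.2 | y <- xs]) x != 0.

Lemma rot0 : rot 0 = 1%:M :> 'M[F]_2.
Proof. by rewrite rotJ scale0r addr0. Qed.

Lemma robust_rot e r x M l t : `|t| < e -> robust e r x (M :: l) ->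
  robust e r (M *m rot t *m x) l.
Proof.
move=> te H xs s xsl xse se; have := H ((M, t) :: xs) s; rewrite /= xsl.
move=> /(_ erefl); rewrite /ev !mulmxA; apply => // y.
by rewrite inE => /orP[/eqP -> //|]; exact: xse.
Qed.

Lemma robust_last e r x l s : 0 < e -> robust e r x l -> `|s| < e ->
  ev r (rot s *m mprod l) x != 0.
Proof.
move=> e0 H se; have := H [seq (M, 0) | M <- l] s.
have -> : map fst [seq (M, 0 : F) | M <- l] = l by rewrite -map_comp map_id.
move=> /(_ erefl).
have -> : [seq y.1 *m rot y.2 | y <- [seq (M, 0) | M <- l]] = l.
  by rewrite -map_comp -[RHS]map_id; apply: eq_map => M /=; rewrite rot0 mulmx1.
by apply => // y /mapP[M _ ->]; rewrite normr0.
Qed.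

Lemma robust_first e r x l t : robust e r x l -> `|t| < e -> l != [::] ->
  ev r (mprod l *m rot t) x != 0.
Proof.
case: l => // M l H te _; have e0 : 0 < e by apply: le_lt_trans te.
have := robust_last (s := 0) e0 (robust_rot te H).
by rewrite normr0 rot0 mul1mx => /(_ e0); rewrite /ev /= !mulmxA.
Qed.

(** The numerator is the slope in [s] of the nonvanishing affine function
    [ev r (rot s *m mprod l) x]. *)
Lemma cotg_le e r x l : 0 < e -> robust e r x l -> `|cotg r (mprod l) x| <= e^-1.
Proof.
move=> e0 H.
have E s : ev r (rot s *m mprod l) x = ev r (mprod l) x + ev r (J *m mprod l) x * s.
  by rewrite rotJ mulmxDl mul1mx -scalemxAl evDr evZ mulrC.
have aff : e * `|ev r (J *m mprod l) x| <= `|ev r (mprod l) x|.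
  by apply: affine_nonzero => s se; rewrite -E; apply: robust_last H _.
have n0 : ev r (mprod l) x != 0.
  by have := robust_last e0 H (s := 0); rewrite rot0 mul1mx normr0; apply.
by rewrite /cotg normrM normfV ler_pdivrMr ?normr_gt0 // ler_pdivlMl.
Qed.

(** Insert [rot t] before the letters one after the other. Each insertion lowers the cotangent by at
    least [t * kap / 8], by [cotg_step] for the remaining suffix, and the final cotangent is at
    least [- e^-1]. *)
Lemma robust_telescope e kap t r x l : 0 < t -> t < e -> e <= 1 -> 0 <= kap ->
  robust e r x l ->
  (forall l1 l2, l = l1 ++ l2 -> kap * norm1 (mprod l2) ^+ 2 <= \det (mprod l2)) ->
  (size l)%:R * (t * kap / 8) <= cotg r (mprod l) x + e^-1.
Proof.
move=> t0 te e1 k0; have e0 := lt_trans t0 te.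
have tn : `|t| < e by rewrite gtr0_norm.
elim: l x => [|M l IH] x H K.
  rewrite mul0r; have := cotg_le e0 H; rewrite ler_norml => /andP[]; lra.
have := IH _ (robust_rot tn H) _.
have st := cotg_step t0 te e1 k0 _ (K [::] _ erefl).
have := st r x _ => {}st.
have {}st := st (fun s se => robust_first H se isT).
have -> : cotg r (mprod l) (M *m rot t *m x) = cotg r (mprod (M :: l)) (rot t *m x).
  by rewrite /cotg /ev /= !mulmxA.
have K' l1 l2 : l = l1 ++ l2 -> kap * norm1 (mprod l2) ^+ 2 <= \det (mprod l2).
  by move=> E; apply: (K (M :: l1)); rewrite E.
move=> /(_ K').
by rewrite [size _]/= -(natr1 (size l)) mulrDl mul1r; lra.
Qed.

(** With [t = e / 2], steps of size [e * kap / 16] have to fit into an interval of length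
    [2 / e]. *)
Lemma robust_det e kap r x l : 0 < e -> e <= 1 -> 0 <= kap ->
  robust e r x l ->
  (forall l1 l2, l = l1 ++ l2 -> kap * norm1 (mprod l2) ^+ 2 <= \det (mprod l2)) ->
  (size l)%:R * kap <= 32 / e ^+ 2.
Proof.
move=> e0 e1 k0 H K.
have tel := @robust_telescope e kap (e / 2) r x l _ _ e1 k0 H K.
have := cotg_le e0 H; rewrite ler_norml => /andP[_ up].
have {}tel := le_trans (tel ltac:(lra) ltac:(lra)) (lerD up (lexx _)).
rewrite ler_pdivlMr ?exprn_gt0 //.
have : (size l)%:R * (e / 2 * kap / 8) * (16 * e) <= (e^-1 + e^-1) * (16 * e).
  by rewrite ler_wpM2r // mulr_ge0 // ltW.
have -> : (e^-1 + e^-1) * (16 * e) = 32 by field; rewrite gt_eqF.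
by apply: le_trans; rewrite le_eqVlt; apply/orP; left; apply/eqP; field.
Qed.
End Separation.

(** * Products along admissible words *)

Section Words.
Variables (F : realType) (k : nat) (adm : rel 'I_k) (A : 'I_k -> 'M[F]_2).

Definition wprod (s : seq 'I_k) : 'M[F]_2 := mprod [seq A b | b <- s].

Lemma wprod_cat s1 s2 : wprod (s1 ++ s2) = wprod s2 *m wprod s1.
Proof. by rewrite /wprod map_cat mprod_cat. Qed.

Definition no_null_word e := forall t, `|t| < e -> forall i s, path adm i s ->
  mprod [seq A b *m rot t | b <- i :: s] != 0.

(* [v a] spans the image in state [a] of the range of a singular letter, and the
   kernel of [r a] is the pullback to state [a] of the kernel of that letter. *)
Lemma exists_robust_frame e : 0 < e -> (forall i, 0 <= \det (A i)) ->
  (exists i, \det (A i) = 0) ->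
  (forall a b, exists s, path adm a (rcons s b)) ->
  no_null_word e ->
  exists (v : 'I_k -> 'cV[F]_2) (r : 'I_k -> 'rV[F]_2),
    forall a s, path adm a s -> robust e (r (last a s)) (v a) [seq A b | b <- s].
Proof.
move=> e0 dA [i di] conn nn.
have [x [l Ai]] := rank1_fact di.
have /(@boolp.choice _ _ _)[pre preP] := conn i.
have /(@boolp.choice _ _ _)[suf sufP] := fun a => conn a i.
exists (fun a => wprod (rcons (pre a) a) *m x), (fun a => l *m wprod (suf a)).
move=> a s adms ys t ysE yse te.
(* The final rotation [rot t] is placed before the first letter of the return word to [i]; the other
   letters of that word get parameter 0. The empty branch never occurs. *)
pose head_t := [seq (A b.1, b.2) | b <- 
  if rcons (suf (last a s)) i is c :: q then (c, t) :: [seq (b, 0 : F) | b <- q] else [::]].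
have headE : mprod [seq y.1 *m rot y.2 | y <- head_t] =
    wprod (rcons (suf (last a s)) i) *m rot t.
  rewrite /head_t /wprod; case: (rcons _ _) (size_rcons (suf (last a s)) i) => //= c q _.
  rewrite -mulmxA; congr (mprod _ *m _); rewrite -!map_comp.
  by apply: eq_map => b /=; rewrite rot0 mulmx1.
pose xs := [seq (A b, 0 : F) | b <- rcons (pre a) a] ++ ys ++ head_t.
have xs1 : map fst xs = [seq A b | b <- rcons (pre a) a ++ s ++ rcons (suf (last a s)) i].
  rewrite /xs !map_cat ysE -!map_comp; congr (_ ++ (_ ++ _)).
  rewrite /head_t; case: (rcons _ _) (size_rcons (suf (last a s)) i) => //= c q _.
  by rewrite -!map_comp.
have pE : path adm i (rcons (pre a) a ++ s ++ rcons (suf (last a s)) i).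
  by rewrite cat_path preP last_rcons cat_path adms sufP.
have xsP y : y \in xs -> 0 <= \det y.1 /\ `|y.2| < e.
  case: y => M y Min; split.
    have : M \in map fst xs by apply/mapP; exists (M, y).
    by rewrite xs1 => /mapP[b _ ->]; exact: dA.
  move: Min; rewrite /xs !mem_cat => /or3P[/mapP[b _ [_ ->]]|/yse //|].
    by rewrite /= normr0.
  rewrite /head_t => /mapP[[b u] + [_ ->]] /=.
  case: (rcons _ _) => // c q; rewrite inE => /orP[/eqP[_ ->] //|/mapP[? _ [_ ->]]].
  by rewrite /= normr0.
(* The word [i :: ...] is admissible, and its first letter is [x *m l]; a product annihilating [x]
   would make it a null word. *)
have unif u : `|u| < e -> mprod [seq y.1 *m rot u | y <- xs] *m x != 0.
  move=> ue; apply/eqP => E; have := nn u ue _ _ pE.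
  rewrite /= Ai.
  have <- : [seq y.1 *m rot u | y <- xs] =
     [seq A b *m rot u | b <- rcons (pre a) a ++ s ++ rcons (suf (last a s)) i].
    by rewrite [RHS](map_comp (fun M => M *m rot u) A) -xs1 -map_comp.
  by rewrite !mulmxA E !mul0mx eqxx.
have := nonuniform_perturbation e0 xsP unif.
rewrite /xs !map_cat !mprod_cat headE.
have -> : mprod [seq y.1 *m rot y.2 | y <- [seq (A b, 0) | b <- rcons (pre a) a]] =
   wprod (rcons (pre a) a).
  by rewrite /wprod -map_comp; congr mprod; apply: eq_map => b /=; rewrite rot0 mulmx1.
rewrite -cats1 wprod_cat {1}/wprod /= mul1mx Ai -!mulmxA.
set B := l *m _; apply: contra => /eqP B0; apply/eqP.
rewrite (_ : B = 0) ?mulmx0 //; apply/matrixP => u w; rewrite (ord1 u) (ord1 w) [RHS]mxE.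
by rewrite -[RHS]B0 /ev /B -!mulmxA.
Qed.

Variables (e : F) (v : 'I_k -> 'cV[F]_2) (r : 'I_k -> 'rV[F]_2).
Hypotheses (e0 : 0 < e) (e1 : e <= 1).
Hypothesis rob : forall a s, path adm a s ->
  robust e (r (last a s)) (v a) [seq A b | b <- s].

Lemma robust_cat rr x l1 l2 : robust e rr x (l1 ++ l2) -> robust e rr (mprod l1 *m x) l2.
Proof.
elim: l1 x => [|M l1 IH] x /=; first by rewrite mul1mx.
have n0 : `|0 : F| < e by rewrite normr0.
by move/(robust_rot n0)/IH; rewrite rot0 mulmx1 mulmxA.
Qed.

Lemma robust_ev_le rr x l : robust e rr x l ->
  e ^+ 2 * (norm1 rr * norm1 (mprod l) * norm1 x) <= 96 * `|ev rr (mprod l) x|.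
Proof.
case: l => [|M l] H; last first.
  apply: nonzero_square_bound => // s t se te.
  have := robust_last e0 (robust_rot te H) se.
  by rewrite /ev /= !mulmxA.
(* For the empty word only the final rotation is available. The other values needed follow from it,
   as [J] commutes with the identity and squares to minus the identity. *)
have aff : e * `|ev rr (J F) x| <= `|ev rr 1%:M x|.
  apply: affine_nonzero => t te; have := robust_last e0 H te.
  by rewrite mulmx1 rotJ evDr evZ mulrC.
have := norm1_le_ev rr 1%:M x; rewrite mulmx1 !mul1mx.
have -> : J F *m J F = -1 *: 1%:M.
  apply/matrixP => i j; rewrite !(mul2E, mxE) /=.
  by case: (ord2P i) => ->; case: (ord2P j) => -> /=; rewrite ?mulr1n ?mulr0n; ring.
rewrite evZ mulN1r normrN /=.
have a0 := normr_ge0 (ev rr 1%:M x); have b0 := normr_ge0 (ev rr (J F) x).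
move: aff a0 b0; move: `|ev rr 1%:M x| `|ev rr (J F) x| => a b aff a0 b0.
move: (norm1 rr * _ * _) => T TS.
have ee : e ^+ 2 <= e by rewrite expr2 ler_piMl // ltW.
have : e ^+ 2 * T <= e ^+ 2 * (16 * (a + b + b + a)) by rewrite ler_wpM2l ?sqr_ge0.
have h1 : e ^+ 2 * b <= e * b by rewrite ler_wpM2r.
have h2 : e ^+ 2 * a <= a by rewrite -[leRHS]mul1r ler_wpM2r // (le_trans ee).
by rewrite !mulrDr; lra.
Qed.

Let c := e ^+ 2 / 96.

Let c_gt0 : 0 < c. Proof. by rewrite divr_gt0 ?exprn_gt0. Qed.

Lemma robust_ev_ge rr x l : robust e rr x l ->
  c * (norm1 rr * norm1 (mprod l) * norm1 x) <= `|ev rr (mprod l) x|.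
Proof. by move/robust_ev_le; rewrite /c; lra. Qed.

Lemma robust_neq0 rr x l : robust e rr x l ->
  [/\ 0 < norm1 rr, 0 < norm1 (mprod l) & 0 < norm1 x].
Proof.
move=> H; have := robust_last e0 H (s := 0); rewrite normr0 => /(_ e0).
rewrite rot0 mul1mx !norm1_gt0 /ev => E; split; apply: contraNneq E => ->.
- by rewrite !mul0mx mxE.
- by rewrite mulmx0 mul0mx mxE.
- by rewrite mulmx0 mxE.
Qed.

(** Each factor costs one [c]: robustness of [s1] bounds the image of [v a] under [wprod s1] from
    below, and robustness of [s2], started at that image, bounds the whole product. *)
Lemma quasi_multiplicative a s1 s2 : path adm a (s1 ++ s2) ->
  c ^+ 2 * (norm1 (wprod s2) * norm1 (wprod s1)) <= norm1 (wprod (s1 ++ s2)).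
Proof.
move=> p12; have rob12 := rob p12.
have /andP[p1 _] : path adm a s1 && path adm (last a s1) s2 by rewrite -cat_path.
have rob1 := rob p1.
rewrite map_cat in rob12; have rob2 := robust_cat rob12.
have [r0 _ v0] := robust_neq0 rob12.
have [r10 _ _] := robust_neq0 rob1.
have h2 := robust_ev_ge rob2.
have h1 := robust_ev_ge rob1.
rewrite -/(wprod s1) -/(wprod s2) in h1 h2.
set rr := r _ in r0 h2; set r1 := r _ in r10 h1; set x := v a in v0 h1 h2.
have g1 : c * (norm1 (wprod s1) * norm1 x) <= norm1 (wprod s1 *m x).
  rewrite -(ler_pM2l r10) mulrCA [norm1 r1 * (norm1 _ * _)]mulrA; apply: le_trans h1 _.
  by rewrite /ev -mulmxA -norm1_11 norm1_mul.
have g2 : `|ev rr (wprod s2) (wprod s1 *m x)| <= norm1 rr * norm1 (wprod (s1 ++ s2)) * norm1 x.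
  by rewrite wprod_cat; apply: le_trans (ev_le _ _ _); rewrite /ev !mulmxA.
rewrite -(ler_pM2l r0) -(ler_pM2r v0); apply: le_trans g2.
apply: le_trans h2.
have -> : norm1 rr * (c ^+ 2 * (norm1 (wprod s2) * norm1 (wprod s1))) * norm1 x =
  (norm1 rr * (c * norm1 (wprod s2))) * (c * (norm1 (wprod s1) * norm1 x)) by ring.
have -> : c * (norm1 rr * norm1 (wprod s2) * norm1 (wprod s1 *m x)) =
  (norm1 rr * (c * norm1 (wprod s2))) * norm1 (wprod s1 *m x) by ring.
by rewrite ler_wpM2l // !mulr_ge0 ?norm1_ge0 // ltW.
Qed.

(** By quasi-multiplicativity, each suffix of [s] has a ratio of determinant to squared norm at
    least [c ^+ 4] times that of [s]. This is the [kap] for which [robust_det] bounds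
    [size s * kap]. *)
Lemma det_decay a s : (forall i, 0 <= \det (A i)) -> path adm a s ->
  0 < norm1 (wprod s) /\
  (size s).+1%:R * \det (wprod s) <= (32 / (e ^+ 2 * c ^+ 4) + 1) * norm1 (wprod s) ^+ 2.
Proof.
move=> dA ps; have [_ w0 _] := robust_neq0 (rob ps).
rewrite -/(wprod s) in w0; split => //.
have det_ge0 l : 0 <= \det (wprod l).
  by elim: l => [|b l IH]; rewrite /wprod /= ?det1 // det_mulmx mulr_ge0.
have c4 : 0 < c ^+ 4 by rewrite exprn_gt0.
pose kap := c ^+ 4 * \det (wprod s) / norm1 (wprod s) ^+ 2.
have kap0 : 0 <= kap by rewrite divr_ge0 ?sqr_ge0 // mulr_ge0 // ltW.
have w2 : 0 < norm1 (wprod s) ^+ 2 by rewrite exprn_gt0.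
have := robust_det e0 e1 kap0 (rob ps).
rewrite size_map => H.
have {}H : (size s)%:R * kap <= 32 / e ^+ 2.
  apply: H => l1 l2 E.
  pose s1 := take (size l1) s; pose s2 := drop (size l1) s.
  have E1 : l1 = [seq A b | b <- s1] by rewrite map_take E take_size_cat.
  have E2 : l2 = [seq A b | b <- s2] by rewrite map_drop E drop_size_cat.
  have s12 : s1 ++ s2 = s by rewrite cat_take_drop.
  rewrite E2 -/(wprod s2).
  have qm := @quasi_multiplicative a s1 s2; rewrite s12 in qm; have {}qm := qm ps.
  rewrite /kap mulrAC ler_pdivrMr //.
  have -> : \det (wprod s) = \det (wprod s2) * \det (wprod s1).
    by rewrite -s12 wprod_cat det_mulmx.
  have d1 : \det (wprod s1) <= norm1 (wprod s1) ^+ 2.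
    exact: le_trans (ler_norm _) (det_le_norm1 _).
  have -> : c ^+ 4 * (\det (wprod s2) * \det (wprod s1)) * norm1 (wprod s2) ^+ 2 =
    \det (wprod s2) * (c ^+ 4 * \det (wprod s1) * norm1 (wprod s2) ^+ 2) by ring.
  rewrite ler_wpM2l //.
  apply: le_trans (_ : (c ^+ 2 * (norm1 (wprod s2) * norm1 (wprod s1))) ^+ 2 <= _).
    have -> : (c ^+ 2 * (norm1 (wprod s2) * norm1 (wprod s1))) ^+ 2 =
      c ^+ 4 * norm1 (wprod s1) ^+ 2 * norm1 (wprod s2) ^+ 2 by ring.
    by rewrite ler_wpM2r ?sqr_ge0 // ler_wpM2l // ltW.
  rewrite ler_sqr ?nnegrE ?norm1_ge0 //.
  by rewrite (mulr_ge0 (sqr_ge0 c) (mulr_ge0 (norm1_ge0 _) (norm1_ge0 _))).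
(* The summand 1 of the constant pays for passing from [size s] to [(size s).+1]. *)
rewrite -natr1 mulrDl mul1r mulrDl mul1r; apply: lerD; last first.
  exact: le_trans (ler_norm _) (det_le_norm1 _).
rewrite -(ler_pM2l c4) [leRHS]mulrA -ler_pdivrMr //.
have -> : c ^+ 4 * ((size s)%:R * \det (wprod s)) / norm1 (wprod s) ^+ 2 = (size s)%:R * kap.
  by rewrite /kap; ring.
apply: le_trans H _; rewrite le_eqVlt; apply/orP; left; apply/eqP.
by field; rewrite !gt_eqF.
Qed.
End Words.

(** * Limits of contracted directions *)

Section Limit.
Variable F : realType.
Implicit Types (M N : 'M[F]_2) (u x y : 'cV[F]_2).

(** Cramer's rule recovers the columns of [M], times the wedge, from [M *m x] and [M *m y]. *)
Lemma wedge_le M x y : `|wedge x y| * norm1 M <= norm1 y * norm1 (M *m x) + norm1 x * norm1 (M *m y).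
Proof.
rewrite !norm1_col norm1_sq.
have E0 i : wedge x y * M i 0 = y 1 0 * (M *m x) i 0 - x 1 0 * (M *m y) i 0.
  by rewrite !mul2E /wedge; ring.
have E1 i : wedge x y * M i 1 = x 0 0 * (M *m y) i 0 - y 0 0 * (M *m x) i 0.
  by rewrite !mul2E /wedge; ring.
have B0 i : `|wedge x y| * `|M i 0| <= `|y 1 0| * `|(M *m x) i 0| + `|x 1 0| * `|(M *m y) i 0|.
  by rewrite -!normrM E0 (le_trans (ler_normB _ _)).
have B1 i : `|wedge x y| * `|M i 1| <= `|x 0 0| * `|(M *m y) i 0| + `|y 0 0| * `|(M *m x) i 0|.
  by rewrite -!normrM E1 (le_trans (ler_normB _ _)).
by move: (B0 0) (B0 1) (B1 0) (B1 1); rewrite !mulrDl !mulrDr; lra.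
Qed.

Lemma norm1_J x : norm1 (J F *m x) = norm1 x.
Proof.
rewrite !norm1_col addrC; congr (_ + _).
  by congr `|_|; rewrite !(mul2E, mxE) /= ?mulr1n ?mulr0n; ring.
by rewrite -normrN; congr `|_|; rewrite !(mul2E, mxE) /= ?mulr1n ?mulr0n; ring.
Qed.

(** A vector orthogonal to the larger row of [M] is sent to a vector with one entry zero and the
    other [\det M] up to sign. Its norm is that of the row, at least half of [norm1 M]. *)
Lemma exists_contracted M : exists x, norm1 x = 1 /\ norm1 (M *m x) * norm1 M <= 2 * `|\det M|.
Proof.
have [->|M0] := eqVneq M 0.
  exists (delta_mx 0 0); split; first by rewrite norm1_col !mxE /= normr1 normr0 addr0.
  by rewrite mul0mx !norm1_0 mulr0 mulr_ge0.
have Mp : 0 < norm1 M by rewrite norm1_gt0.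
have det2 y : y != 0 -> norm1 (M *m y) = `|\det M| -> norm1 M <= 2 * norm1 y ->
    exists x, norm1 x = 1 /\ norm1 (M *m x) * norm1 M <= 2 * `|\det M|.
  move=> y0 My yM; have yp : 0 < norm1 y by rewrite norm1_gt0.
  exists ((norm1 y)^-1 *: y); rewrite -scalemxAr !norm1Z gtr0_norm ?invr_gt0 //.
  rewrite mulVf ?gt_eqF //; split => //.
  rewrite My -mulrA mulrC ler_pdivrMr // [2 * _]mulrC -mulrA.
  by rewrite ler_wpM2l.
have main i i' : (i, i') \in [:: (0, 1); (1, 0)] ->
    `|M i' 0| + `|M i' 1| <= `|M i 0| + `|M i 1| ->
    exists x, norm1 x = 1 /\ norm1 (M *m x) * norm1 M <= 2 * `|\det M|.
  move=> ii' Mi.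
  have tot : norm1 M <= 2 * (`|M i 0| + `|M i 1|).
    by rewrite norm1_sq; move: ii' Mi; rewrite !inE => /orP[] /eqP[-> ->]; lra.
  apply: (det2 (\col_j (if j == 0 then - M i 1 else M i 0))).
  - apply: contra M0 => /eqP E; rewrite -norm1_eq0.
    have a : M i 1 = 0 by move/matrixP/(_ 0 0): E; rewrite !mxE /= => /eqP; rewrite oppr_eq0 => /eqP.
    have b : M i 0 = 0 by move/matrixP/(_ 1 0): E; rewrite !mxE /=.
    by rewrite eq_le norm1_ge0 andbT (le_trans tot) // a b normr0 addr0 mulr0.
  - rewrite norm1_col !mul2E !mxE /= det2E.
    move: ii'; rewrite !inE => /orP[] /eqP[-> _].
      rewrite [X in `|X| + _](_ : _ = 0); last by ring.
      by rewrite normr0 add0r; congr `|_|; ring.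
    rewrite [X in _ + `|X|](_ : _ = 0); last by ring.
    by rewrite normr0 addr0 -normrN; congr `|_|; ring.
  by rewrite norm1_col !mxE /= normrN addrC.
case: (leP (`|M 0 0| + `|M 0 1|) (`|M 1 0| + `|M 1 1|)) => [h|/ltW h].
  by apply: (main 1 0) h.
by apply: (main 0 1) h.
Qed.

Lemma subseq_cvg_oo (f : nat -> nat) : {mono f : n m / (n <= m)%N >-> (n <= m)%O} ->
  (forall n, (n <= f n)%N) /\ f n @[n --> \oo] --> \oo.
Proof.
move=> fi.
have fn n : (n <= f n)%N.
  elim: n => // n IH; apply: leq_ltn_trans IH _.
  by rewrite ltnNge; have := fi n.+1 n; rewrite leEnat => ->; rewrite ltnn.
by split => // S [N _ SN]; exists N => // n /= Nn; apply: SN => /=; apply: leq_trans Nn _.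
Qed.

(** Compactness of the unit sphere: Bolzano-Weierstrass is applied to one coordinate and then, along
    that subsequence, to the other. *)
Lemma unit_limit (x : nat -> 'cV[F]_2) (M : nat -> 'M[F]_2) (eta : nat -> F) :
  (forall n, norm1 (x n) = 1) ->
  (forall n m, (n <= m)%N -> norm1 (M n *m x m) <= eta n) ->
  exists y, norm1 y = 1 /\ forall n, norm1 (M n *m y) <= eta n.
Proof.
move=> x1 Mx.
have bnd i (h : nat -> nat) : bounded_fun (fun n => x (h n) i 0).
  exists 1; split => // r r1 n _ /=; apply: le_trans (ltW r1).
  rewrite -(x1 (h n)) norm1_col.
  by case: (ord2P i) => ->; rewrite ?lerDl ?lerDr.
have [f fi /cvg_ex[/= a fa]] := bolzano_weierstrass (bnd 0 id).
have [g gi /cvg_ex[/= b gb]] := bolzano_weierstrass (bnd 1 f).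
have [gn goo] := subseq_cvg_oo gi; have [fn foo] := subseq_cvg_oo fi.
have ga : x (f (g n)) 0 0 @[n --> \oo] --> a by apply: (cvg_comp _ _ goo fa).
pose y : 'cV[F]_2 := \col_i (if i == 0 then a else b).
have lim N : norm1 (N *m x (f (g n))) @[n --> \oo] --> norm1 (N *m y).
  rewrite norm1_col !mul2E !mxE /=; under eq_fun do rewrite norm1_col !mul2E.
  apply: cvgD; apply: cvg_norm; apply: cvgD; apply: cvgM => //; exact: cvg_cst.
exists y; split.
  apply/eqP; rewrite eq_le -[y]mul1mx; apply/andP; split.
    by apply: cvgr_to_le (lim _) _; apply: nearW => n; rewrite mul1mx x1.
  by apply: cvgr_to_ge (lim _) _; apply: nearW => n; rewrite mul1mx x1.
move=> n; apply: cvgr_to_le (lim _) _; exists n => // m /= nm; apply: Mx.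
exact: leq_trans nm (leq_trans (gn _) (fn _)).
Qed.

(** A relative decay of order 1/n is enough to determine the line of [x], see [contracted_wedge]. *)
Definition contracted (K : F) (M : nat -> 'M[F]_2) x :=
  norm1 x = 1 /\ forall n, n.+1%:R * norm1 (M n *m x) <= K * norm1 (M n).

(** The most contracted directions [x n] of [M n] satisfy a Cauchy estimate, so [M n] also contracts
    every later [x m], at a rate independent of [m]. A limit point inherits this. *)
Lemma exists_contracted_limit (c K : F) (M : nat -> 'M[F]_2) (X : nat -> nat -> 'M[F]_2) :
  0 < c -> 0 <= K ->
  (forall n, 0 < norm1 (M n)) ->
  (forall n, n.+1%:R * `|\det (M n)| <= K * norm1 (M n) ^+ 2) ->
  (forall n m, (n <= m)%N -> M m = X n m *m M n /\ c * (norm1 (X n m) * norm1 (M n)) <= norm1 (M m)) ->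
  exists x, contracted (8 * K + 4 * K / c) M x.
Proof.
move=> c0 K0 M0 dM XM.
have /(@boolp.choice _ _ _)[x xP] := fun n => exists_contracted (M n).
have n0 n : 0 < n.+1%:R :> F by rewrite ltr0n.
have x1 n : norm1 (x n) = 1 by case: (xP n).
have Mx n : n.+1%:R * norm1 (M n *m x n) <= 2 * K * norm1 (M n).
  rewrite -(ler_pM2r (M0 n)) -[leLHS]mulrA.
  apply: le_trans (_ : n.+1%:R * (2 * `|\det (M n)|) <= _).
    by rewrite ler_wpM2l ?(ltW (n0 _)) //; case: (xP n).
  by have := dM n; lra.
(* [M m] contracts [x m] by choice and [x n] because it factors through [M n] with little loss of
   norm; [wedge_le] then makes the two nearly parallel. *)
have wx n m : (n <= m)%N -> n.+1%:R * `|wedge (x n) (x m)| <= 2 * K / c + 2 * K.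
  move=> nm; have [Mm cM] := XM n m nm.
  rewrite -(ler_pM2r (M0 m)) -[leLHS]mulrA.
  apply: le_trans (_ : n.+1%:R * (norm1 (M m *m x n) + norm1 (M m *m x m)) <= _).
    rewrite ler_wpM2l ?(ltW (n0 _)) //.
    by have := wedge_le (M m) (x n) (x m); rewrite !x1 !mul1r.
  rewrite mulrDr mulrDl; apply: lerD.
    apply: le_trans (_ : n.+1%:R * (norm1 (X n m) * norm1 (M n *m x n)) <= _).
      by rewrite ler_wpM2l ?(ltW (n0 _)) // Mm -mulmxA norm1_mul.
    rewrite mulrCA; apply: le_trans (_ : norm1 (X n m) * (2 * K * norm1 (M n)) <= _).
      by rewrite ler_wpM2l ?norm1_ge0.
    rewrite [leRHS]mulrAC ler_pdivlMr //.
    have -> : norm1 (X n m) * (2 * K * norm1 (M n)) * c = 2 * K * (c * (norm1 (X n m) * norm1 (M n))) by ring.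
    by rewrite ler_wpM2l // mulr_ge0.
  apply: le_trans (Mx m); rewrite ler_wpM2r ?norm1_ge0 // ler_nat ltnS //.
have key n m : (n <= m)%N -> n.+1%:R * norm1 (M n *m x m) <= (8 * K + 4 * K / c) * norm1 (M n).
  move=> nm; have wnm := wx n m nm; have Mn := Mx n.
  have x2 := norm1_col_sqr (x n); rewrite x1 expr1n in x2.
  (* Expansion of [x m] in the orthogonal basis [x n], [J *m x n]. *)
  have E : dot (x n) (x n) *: x m = dot (x n) (x m) *: x n + wedge (x n) (x m) *: (J F *m x n).
    apply/matrixP => i j; rewrite (ord1 j) !(mul2E, mxE) /= /dot /wedge.
    by case: (ord2P i) => -> /=; rewrite ?mulr1n ?mulr0n; ring.
  have d1 : `|dot (x n) (x m)| <= 1.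
    rewrite /dot; apply: le_trans (ler_normD _ _) _; rewrite !normrM.
    have := x1 n; have := x1 m; rewrite !norm1_col.
    have := normr_ge0 (x n 0 0); have := normr_ge0 (x n 1 0).
    have := normr_ge0 (x m 0 0); have := normr_ge0 (x m 1 0).
    by nra.
  have le : dot (x n) (x n) * norm1 (M n *m x m) <=
     norm1 (M n *m x n) + `|wedge (x n) (x m)| * norm1 (M n).
    have d0 : 0 <= dot (x n) (x n) by rewrite /dot -!expr2 addr_ge0 ?sqr_ge0.
    rewrite -{1}(ger0_norm d0) -norm1Z scalemxAr E mulmxDr -!scalemxAr.
    apply: le_trans (norm1D _ _) _; rewrite !norm1Z; apply: lerD.
      by rewrite -[leRHS]mul1r ler_wpM2r ?norm1_ge0.
    by rewrite ler_wpM2l // (le_trans (norm1_mul _ _)) // norm1_J x1 mulr1.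
  have {}x2 : 1 <= 2 * dot (x n) (x n) by rewrite /dot -!expr2.
  have le2 : norm1 (M n *m x m) <= 2 * (norm1 (M n *m x n) + `|wedge (x n) (x m)| * norm1 (M n)).
    by have := norm1_ge0 (M n *m x m); nra.
  apply: le_trans (_ : n.+1%:R * (2 * (norm1 (M n *m x n) + `|wedge (x n) (x m)| * norm1 (M n))) <= _).
    by rewrite ler_wpM2l ?(ltW (n0 _)).
  have : n.+1%:R * `|wedge (x n) (x m)| * norm1 (M n) <= (2 * K / c + 2 * K) * norm1 (M n).
    by rewrite ler_wpM2r // ltW.
  by move: Mn; rewrite !mulrDl !mulrDr; lra.
have [|y [y1 yP]] := @unit_limit x M (fun n => (8 * K + 4 * K / c) * norm1 (M n) / n.+1%:R) x1.
  by move=> n m nm; rewrite ler_pdivlMr // mulrC key.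
by exists y; split => // n; rewrite mulrC -ler_pdivlMr.
Qed.

Lemma linear_bound_eq0 (a C : F) : 0 <= a -> (forall n : nat, n.+1%:R * a <= C) -> a = 0.
Proof.
move=> a0 H; apply/eqP; rewrite eq_le a0 andbT leNgt; apply/negP => ap.
have C0 : 0 <= C / a by exact: divr_ge0 (le_trans (mulr_ge0 (ler0n _ _) a0) (H 0%N)) a0.
have := archi_boundP C0; rewrite ltr_pdivrMr //.
set n := Num.Def.archi_bound _ => lt; have := le_lt_trans (H n) lt.
by rewrite ltr_pM2r // ltr_nat ltnNge leqnSn.
Qed.

Lemma exists_inv_lt (C eps : F) : 0 <= C -> 0 < eps -> exists n : nat, C < eps * n.+1%:R.
Proof.
move=> C0 e0; have := archi_boundP (divr_ge0 C0 (ltW e0)); rewrite ltr_pdivrMr // => h.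
exists (Num.Def.archi_bound (C / eps)); apply: lt_le_trans h _.
by rewrite mulrC ler_wpM2l ?ler_nat // ltW.
Qed.

Lemma cvg_add_vanishing (a b : F) (t : nat -> F) : (forall n, `|t n| < n.+1%:R^-1) ->
  (fun n => a + t n * b) @ \oo --> a.
Proof.
move=> tn; have t0 : t n @[n --> \oo] --> (0 : F).
  apply/cvgrPdist_lt => eps eps0.
  have [N hN] := exists_inv_lt ler01 eps0.
  exists N => // n /= Nn; rewrite sub0r normrN; apply: lt_le_trans (tn n) _.
  rewrite -[leLHS]mul1r ler_pdivrMr // ltW // (lt_le_trans hN) //.
  by rewrite ler_wpM2l ?(ltW eps0) // ler_nat.
rewrite -[X in _ --> X]addr0 -[X in _ --> _ + X](mul0r b).
by apply: cvgD; [exact: cvg_cst|apply: cvgM; [exact: t0|exact: cvg_cst]].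
Qed.

(** By [wedge_le] the wedge is of order 1/n for every n. This uniqueness yields the invariance of
    both line fields. *)
Lemma contracted_wedge K C (M : nat -> 'M[F]_2) x y : (forall n, 0 < norm1 (M n)) ->
  contracted K M x -> (forall n, n.+1%:R * norm1 (M n *m y) <= C * norm1 (M n)) ->
  wedge x y = 0.
Proof.
move=> M0 [x1 Mx] My; apply/eqP; rewrite -normr_eq0; apply/eqP.
apply: (@linear_bound_eq0 _ (norm1 y * K + C)) => // n.
rewrite -(ler_pM2r (M0 n)) -[leLHS]mulrA.
apply: le_trans (_ : n.+1%:R * (norm1 y * norm1 (M n *m x) + norm1 (M n *m y)) <= _).
  by rewrite ler_wpM2l // (le_trans (wedge_le _ _ _)) // x1 mul1r.
rewrite mulrDr mulrDl; apply: lerD => //.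
by rewrite mulrCA -mulrA ler_wpM2l ?norm1_ge0.
Qed.

(** Agreement at the single index [n] suffices. As the n-th product depends on finitely many
    coordinates, this yields continuity. *)
Lemma contracted_close K (M : nat -> 'M[F]_2) (M' : nat -> 'M[F]_2) x y n :
  0 < norm1 (M n) -> M n = M' n -> contracted K M x -> contracted K M' y ->
  n.+1%:R * `|wedge x y| <= 2 * K.
Proof.
move=> M0 E [x1 Mx] [y1 My]; have {}Mx := Mx n; have {}My := My n; rewrite -E in My.
rewrite -(ler_pM2r M0) -[leLHS]mulrA.
apply: le_trans (_ : n.+1%:R * (norm1 (M n *m x) + norm1 (M n *m y)) <= _).
  by rewrite ler_wpM2l // (le_trans (wedge_le _ _ _)) // x1 y1 !mul1r.
by rewrite mulrDr; lra.
Qed.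

(* [\adj N *m x] measures the component of [N] transverse to [x]. *)
Lemma transverse_growth c (M N : 'M[F]_2) x (eta : F) : norm1 x = 1 -> 0 < norm1 N ->
  norm1 (\adj N *m x) <= eta * norm1 N ->
  c * (norm1 M * norm1 N) <= norm1 (M *m N) ->
  (c / 2 - eta) * norm1 M <= norm1 (M *m x).
Proof.
move=> x1 N0 aN cMN.
have x2 := norm1_col_sqr x; rewrite x1 expr1n in x2.
(* [p] and [q] hold the components of the columns of [N] along [x] and along [J *m x]; [q] has the
   norm of [\adj N *m x]. *)
pose p : 'rV[F]_2 := \row_j (x 0 0 * N 0 j + x 1 0 * N 1 j).
pose q : 'rV[F]_2 := \row_j (- x 1 0 * N 0 j + x 0 0 * N 1 j).
have E : dot x x *: (M *m N) = (M *m x) *m p + (M *m (J F *m x)) *m q.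
  apply/matrixP => i j; rewrite !(mul2E, mxE, big_ord1) /= /dot ?mulr1n ?mulr0n; ring.
have p1 : norm1 p <= norm1 N.
  have a0 : `|x 0 0| <= 1 by rewrite -x1 norm1_col lerDl.
  have a1 : `|x 1 0| <= 1 by rewrite -x1 norm1_col lerDr.
  have H (s t : F) : `|x 0 0 * s + x 1 0 * t| <= `|s| + `|t|.
    apply: le_trans (ler_normD _ _) _; rewrite !normrM.
    by apply: lerD; rewrite -[leRHS]mul1r ler_wpM2r.
  by rewrite norm1_row norm1_sq !mxE; move: (H (N 0 0) (N 1 0)) (H (N 0 1) (N 1 1)); lra.
have q1 : norm1 q = norm1 (\adj N *m x).
  rewrite norm1_row norm1_col adj2E !(mul2E, mxE) /=.
  have -> : (1 - 0 : 'I_2) = 1 by apply/val_inj.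
  have -> : (1 - 1 : 'I_2) = 0 by apply/val_inj.
  rewrite [LHS]addrC; congr (_ + _); first by congr `|_|; ring.
  by rewrite -normrN; congr `|_|; ring.
have le : dot x x * norm1 (M *m N) <= norm1 (M *m x) * norm1 N + norm1 M * (eta * norm1 N).
  have d0 : 0 <= dot x x by rewrite /dot -!expr2 addr_ge0 ?sqr_ge0.
  rewrite -{1}(ger0_norm d0) -norm1Z E; apply: le_trans (norm1D _ _) _; apply: lerD.
    by apply: le_trans (norm1_mul _ _) _; rewrite ler_wpM2l ?norm1_ge0.
  apply: le_trans (norm1_mul _ _) _; rewrite q1; apply: ler_pM; rewrite ?norm1_ge0 //.
  by apply: le_trans (norm1_mul _ _) _; rewrite norm1_J x1 mulr1.
have {}x2 : 1 <= 2 * dot x x by rewrite /dot -!expr2.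
have h : norm1 (M *m N) <= 2 * (norm1 (M *m x) * norm1 N + norm1 M * (eta * norm1 N)).
  by have := norm1_ge0 (M *m N); nra.
rewrite -(ler_pM2r N0).
have := le_trans cMN h.
by rewrite !mulrDl !mulrDr; lra.
Qed.
End Limit.

(** * Projective uniform hyperbolicity *)

Definition window k (w : seqZ k) (m : int) (n : nat) : seq 'I_k :=
  [seq w (m + i%:Z) | i <- iota 0 n].

Lemma size_window k (w : seqZ k) m n : size (window w m n) = n.
Proof. by rewrite size_map size_iota. Qed.

Lemma windowS k (w : seqZ k) m n : window w m n.+1 = w m :: window w (m + 1) n.
Proof.
rewrite /window /= addr0; congr cons.
rewrite -(addn0 1%N) iotaDl -map_comp; apply: eq_map => i /=.
by congr w; lia.
Qed.

Lemma window_cat k (w : seqZ k) m p r :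
  window w m (p + r) = window w m p ++ window w (m + p%:Z) r.
Proof.
elim: p m => [|p IH] m; first by rewrite addr0.
by rewrite addSn !windowS IH /=; congr (_ :: _ ++ window _ _ _); lia.
Qed.

Lemma window_shift k (w : seqZ k) m n : window (Defs.shift w) m n = window w (m + 1) n.
Proof. by apply: eq_map => i; rewrite /Defs.shift; congr w; lia. Qed.

Lemma eq_window k (w w' : seqZ k) m n :
  (forall i : int, m <= i < m + n%:Z -> w i = w' i) -> window w m n = window w' m n.
Proof.
move=> H; apply/eq_in_map => i; rewrite mem_iota add0n /= => ni.
by apply: H; lia.
Qed.

Definition admissible k (P : 'M[R]_k) : rel 'I_k := fun a b => 0 < P b a.

Lemma path_window k (P : 'M[R]_k) (w : seqZ k) m n : inX P w ->
  path (admissible P) (w m) (window w (m + 1) n).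
Proof.
move=> wX; elim: n m => // n IH m; rewrite windowS /= IH andbT.
exact: wX.
Qed.

Lemma inX_shift k (P : 'M[R]_k) w : inX P w -> inX P (Defs.shift w).
Proof. by move=> wX n; exact: wX. Qed.

Lemma Aiter_wprod k (A : 'I_k -> 'M[R]_2) w n : Aiter A w n = wprod A (window w 1 n).
Proof.
elim: n => //= n ->; rewrite -[in RHS](addn1 n) window_cat wprod_cat; congr (_ *m _).
by rewrite /wprod /= mul1mx addr0; congr (A (w _)); lia.
Qed.

Lemma vnorm_le (v : 'cV[R]_2) : vnorm v <= norm1 v.
Proof.
rewrite /vnorm -[leRHS]ger0_norm ?norm1_ge0 // -sqrtr_sqr ler_wsqrtr // norm1_col.
rewrite -(real_normK (num_real (v 0 0))) -(real_normK (num_real (v 1 0))).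
have := normr_ge0 (v 0 0); have := normr_ge0 (v 1 0); nra.
Qed.

Lemma norm1_le_vnorm (v : 'cV[R]_2) : norm1 v <= 2 * vnorm v.
Proof.
have v0 : 0 <= vnorm v := sqrtr_ge0 _.
have := norm1_col_sqr v; rewrite -(@sqr_sqrtr _ (v 0 0 ^+ 2 + _)) ?addr_ge0 ?sqr_ge0 //.
by rewrite -/(vnorm v); have := norm1_ge0 v; nra.
Qed.

Section Hyperbolic.
Variables (k : nat) (P : 'M[R]_k) (A : 'I_k -> 'M[R]_2) (c K : R).
Hypotheses (c0 : 0 < c) (K0 : 0 <= K) (dA : forall i, 0 <= \det (A i)).
Hypothesis wprod_decay : forall a s, path (admissible P) a s -> 0 < norm1 (wprod A s) /\
  (size s).+1%:R * \det (wprod A s) <= K * norm1 (wprod A s) ^+ 2.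
Hypothesis wprod_qm : forall a s1 s2, path (admissible P) a (s1 ++ s2) ->
  c * (norm1 (wprod A s2) * norm1 (wprod A s1)) <= norm1 (wprod A (s1 ++ s2)).

Let D := 8 * K + 4 * K / c.

Let D0 : 0 <= D.
Proof. by rewrite addr_ge0 ?divr_ge0 ?mulr_ge0 // ltW. Qed.

Definition future (w : seqZ k) n := wprod A (window w 1 n).
(** The iterate A^n at the n-th preimage of [w] under the shift; it arrives in the fibre over
    [w]. *)
Definition past (w : seqZ k) n := wprod A (window w (1 - n%:Z) n).

Lemma window_gt0 w m n : inX P w -> 0 < norm1 (wprod A (window w m n)).
Proof.
move=> wX; have := path_window (m - 1) n wX; rewrite subrK => p.
by case: (wprod_decay p).
Qed.

Lemma window_det w m n : inX P w ->
  n.+1%:R * `|\det (wprod A (window w m n))| <= K * norm1 (wprod A (window w m n)) ^+ 2.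
Proof.
move=> wX; have := path_window (m - 1) n wX; rewrite subrK => p.
rewrite ger0_norm; first by have := (wprod_decay p).2; rewrite size_window.
rewrite /wprod; elim: (window w m n) => [|b l IH] /=; first by rewrite det1.
by rewrite det_mulmx mulr_ge0.
Qed.

Lemma window_qm w m p q : inX P w ->
  c * (norm1 (wprod A (window w (m + p%:Z) q)) * norm1 (wprod A (window w m p))) <=
  norm1 (wprod A (window w m (p + q))).
Proof.
move=> wX; rewrite window_cat; apply: (wprod_qm (a := w (m - 1))).
by rewrite -window_cat -{2}(subrK 1 m); apply: path_window.
Qed.

Lemma exists_future_contracted w : inX P w -> exists x, contracted D (future w) x.
Proof.
move=> wX.
apply: (@exists_contracted_limit _ c K _ (fun n m => wprod A (window w (1 + n%:Z) (m - n)))) => //.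
- by move=> n; apply: window_gt0.
- by move=> n; apply: window_det.
move=> n m nm; rewrite /future; split.
  by rewrite -wprod_cat -window_cat subnKC.
by have := window_qm 1 n (m - n) wX; rewrite subnKC.
Qed.

(** In [past] the older letters stand on the right. The adjugate reverses products, which puts them
    on the left as [exists_contracted_limit] requires. A direction contracted by the adjugates is
    one along which the images of [past] concentrate. *)
Lemma exists_past_contracted w : inX P w ->
  exists x, contracted D (fun n => \adj (past w n)) x.
Proof.
move=> wX.
apply: (@exists_contracted_limit _ c K _
  (fun n m => \adj (wprod A (window w (1 - m%:Z) (m - n))))) => //.
- by move=> n; rewrite norm1_adj2; apply: window_gt0.
- by move=> n; rewrite norm1_adj2 det_adj2; apply: window_det.
move=> n m nm; rewrite !norm1_adj2 -adj2M.
have E : past w m = wprod A (window w (1 - n%:Z) n) *m wprod A (window w (1 - m%:Z) (m - n)).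
  rewrite -wprod_cat /past -{2}(subnK nm) window_cat.
  by congr (wprod A (_ ++ window w _ _)); lia.
split; first by rewrite E.
have := window_qm (1 - m%:Z) (m - n) n wX; rewrite subnK //.
rewrite (_ : 1 - m%:Z + (m - n)%:Z = 1 - n%:Z); last by lia.
by rewrite [norm1 _ * norm1 _]mulrC.
Qed.

Lemma close_continuous (u : seqZ k -> 'cV[R]_2) (M : seqZ k -> nat -> 'M[R]_2) :
  (forall w, inX P w -> contracted D (M w) (u w)) ->
  (forall w n, inX P w -> 0 < norm1 (M w n)) ->
  (forall w w' (n : nat), (forall i : int, `|i| <= n%:Z -> w' i = w i) -> M w n = M w' n) ->
  line_continuous P u.
Proof.
move=> uM M0 Mw w wX eps eps0.
(* [contracted_close] gives [2 * D], and dividing by the two Euclidean norms, each at least 1/2,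
   costs a factor 4. *)
have [n nP] := @exists_inv_lt R (8 * D) eps (mulr_ge0 (ler0n _ 8) D0) eps0.
exists n => w' w'X ww'.
have h := contracted_close (M0 w n wX) (Mw w w' n ww') (uM w wX) (uM w' w'X).
have [u1 _] := uM w wX; have [u1' _] := uM w' w'X.
have := norm1_le_vnorm (u w); rewrite u1 => v1.
have := norm1_le_vnorm (u w'); rewrite u1' => v2.
rewrite /pdist ltr_pdivrMr; last by rewrite mulr_gt0 //; lra.
rewrite -[cross _ _]/(wedge _ _).
have n0 : 0 < n.+1%:R :> R by rewrite ltr0n.
rewrite -(ltr_pM2l n0); apply: le_lt_trans h _.
have v12 : 1 <= 4 * (vnorm (u w) * vnorm (u w')) by nra.
rewrite mulrA [_ * eps]mulrC.
have : 8 * D * 1 < eps * n.+1%:R * (4 * (vnorm (u w) * vnorm (u w'))).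
  apply: lt_le_trans (_ : eps * n.+1%:R * 1 <= _); first by rewrite ltr_pM2r.
  by rewrite ler_wpM2l // ltW // mulr_gt0.
lra.
Qed.

Lemma contracted_neq0 (M : nat -> 'M[R]_2) x : contracted D M x -> x != 0.
Proof. by case=> x1 _; rewrite -norm1_gt0 x1. Qed.

Lemma projective_uniform_hyperbolicity : proj_unif_hyperbolic P A.
Proof.
have /(@boolp.choice _ _ _)[u0 u0P] : forall w, exists x, inX P w -> contracted D (future w) x.
  move=> w; have [wX|nX] := pselect (inX P w); last by exists 0.
  by have [x xP] := exists_future_contracted wX; exists x.
have /(@boolp.choice _ _ _)[u1 u1P] : forall w, exists x, inX P w ->
    contracted D (fun n => \adj (past w n)) x.
  move=> w; have [wX|nX] := pselect (inX P w); last by exists 0.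
  by have [x xP] := exists_past_contracted wX; exists x.
(* This [n] makes the contraction factor at most [c / 16], against a growth factor of at least
   [c / 2 - c / 16]. The gap survives the passage from [norm1] to [vnorm]. *)
have [n nP] := @exists_inv_lt R (16 * D) c (mulr_ge0 (ler0n _ 16) D0) c0.
have n0 : 0 < n.+1%:R :> R by rewrite ltr0n.
have grow w : inX P w -> 7 / 16 * c * norm1 (future w n) <= norm1 (future w n *m u1 w).
  move=> wX; have [x1 xP] := u1P w wX; have := xP n; rewrite norm1_adj2 => xn.
  have N0 : 0 < norm1 (past w n) := window_gt0 _ _ wX.
  have := @transverse_growth _ c (future w n) (past w n) (u1 w) (c / 16) x1 N0.
  have -> : c / 2 - c / 16 = 7 / 16 * c by lra.
  apply.
    rewrite -(ler_pM2l n0); apply: le_trans xn _.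
    by rewrite mulrA ler_wpM2r ?norm1_ge0 //; lra.
  have := window_qm (1 - n%:Z) n n wX; rewrite window_cat wprod_cat.
  by rewrite (_ : 1 - n%:Z + n%:Z = 1) //; lia.
have shrink w : inX P w -> norm1 (future w n *m u0 w) <= c / 16 * norm1 (future w n).
  move=> wX; have [_ xP] := u0P w wX; have xn := xP n.
  rewrite -(ler_pM2l n0); apply: le_trans xn _.
  by rewrite mulrA ler_wpM2r ?norm1_ge0 //; lra.
exists u0, u1; split; [|split; [|split; [|split; [|split]]]].
- apply: (close_continuous u0P); first by move=> w m wX; apply: window_gt0.
  move=> w w' m ww'; congr wprod; apply: eq_window => i im; rewrite ww' //; lia.
- apply: (close_continuous u1P); first by move=> w m wX; rewrite norm1_adj2; apply: window_gt0.
  move=> w w' m ww'; congr (\adj (wprod _ _)); apply: eq_window => i im; rewrite ww' //; lia.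
- move=> w wX; apply/eqP; rewrite -[cross _ _]/(wedge _ _) => w0.
  have [b E] := wedge0_par (contracted_neq0 (u0P w wX)) w0.
  have [x1 _] := u1P w wX; have [y1 _] := u0P w wX.
  have b1 : `|b| = 1 by move: x1; rewrite E norm1Z y1 mulr1.
  have := grow w wX; have := shrink w wX; rewrite E -scalemxAr norm1Z b1 mul1r.
  have : 0 < norm1 (future w n) := window_gt0 _ _ wX.
  by have := c0; nra.
- move=> w wX; have sX := inX_shift wX.
  suff /(wedge0_par (contracted_neq0 (u0P _ sX)))[b ->] :
    wedge (u0 (Defs.shift w)) (A (w 1) *m u0 w) = 0 by exists b.
  (* The image of [u0 w] is contracted by the future of the shifted point, since that future lacks
     only the letter at 1; by uniqueness it lies on the line of [u0]. *)
  apply: (contracted_wedge (C := D * norm1 (A (w 1))) _ (u0P _ sX)).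
    by move=> m; apply: window_gt0.
  move=> m; have E : future w m.+1 = future (Defs.shift w) m *m A (w 1).
    by rewrite /future windowS window_shift.
  have [_ /(_ m.+1)] := u0P _ wX; rewrite E -mulmxA => h.
  apply: le_trans (_ : m.+2%:R * norm1 (future (Defs.shift w) m *m (A (w 1) *m u0 w)) <= _).
    by rewrite ler_wpM2r ?norm1_ge0 // ler_nat.
  apply: le_trans h _; rewrite -mulrA ler_wpM2l // mulrC; exact: norm1_mul.
- move=> w wX; have sX := inX_shift wX.
  suff /(wedge0_par (contracted_neq0 (u1P _ sX)))[b ->] :
    wedge (u1 (Defs.shift w)) (A (w 1) *m u1 w) = 0 by exists b.
  have E m : past (Defs.shift w) m.+1 = A (w 1) *m past w m.
    rewrite /past window_shift -[in window _ _ _](addn1 m) window_cat wprod_cat.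
    rewrite (_ : 1 - (m + 1)%:Z + 1 = 1 - m%:Z); last by lia.
    congr (_ *m _); rewrite (_ : 1 - m%:Z + m%:Z = 1); last by lia.
    by rewrite /wprod /= addr0 mul1mx.
  have A0 : 0 < norm1 (A (w 1)).
    by have := window_gt0 1 1 wX; rewrite /wprod /= addr0 mul1mx.
  have [y1 yP] := u1P _ sX; have [x1 xP] := u1P _ wX.
  (* Index [m.+1] matches [past] at the shifted point with [past w m] followed by the letter at 1.
     The adjugate of that letter cancels it up to its determinant, and quasi-multiplicativity
     compares the norms of the two pasts. *)
  apply: (@contracted_wedge _ D (\det (A (w 1)) * D / (c * norm1 (A (w 1))))
    (fun m => \adj (past (Defs.shift w) m.+1))).
  + by move=> m; rewrite norm1_adj2; apply: window_gt0.
  + split => // m; apply: le_trans (yP m.+1).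
    by rewrite ler_wpM2r ?norm1_ge0 // ler_nat.
  move=> m; rewrite E adj2M -mulmxA [\adj (A _) *m (_ *m _)]mulmxA mul_adj_mx mul_scalar_mx.
  rewrite -scalemxAr norm1Z ger0_norm // -adj2M -E norm1_adj2 mulrCA.
  apply: le_trans (_ : \det (A (w 1)) * (D * norm1 (past w m)) <= _).
    by rewrite ler_wpM2l //; have := xP m; rewrite norm1_adj2.
  have qm := window_qm (1 - m%:Z) m 1 wX.
  have E2 : norm1 (past (Defs.shift w) m.+1) = norm1 (wprod A (window w (1 - m%:Z) (m + 1))).
    by rewrite /past window_shift addn1; congr (norm1 (wprod _ (window _ _ _))); lia.
  rewrite -E2 (_ : 1 - m%:Z + m%:Z = 1) in qm; last by lia.
  rewrite {1}/wprod /= addr0 mul1mx -/(past w m) in qm.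
  rewrite mulrA -[leRHS]mulrA ler_wpM2l ?mulr_ge0 // ler_pdivlMl ?mulr_gt0 //.
  by rewrite -mulrA.
exists n => w wX; rewrite Aiter_wprod -/(future w n).
have [x1 _] := u1P w wX; have [y1 _] := u0P w wX.
have f0 : 0 < norm1 (future w n) := window_gt0 _ _ wX.
have := norm1_le_vnorm (u0 w); rewrite y1 => v0.
have := vnorm_le (u1 w); rewrite x1 => v1.
have := norm1_le_vnorm (u1 w); rewrite x1 => v1'.
have := le_trans (vnorm_le _) (shrink w wX) => a.
have := le_trans (grow w wX) (norm1_le_vnorm _) => b.
have V0 : 0 < vnorm (u0 w) by lra.
have V1 : 0 < vnorm (u1 w) by lra.
have cf : 0 < c * norm1 (future w n) by rewrite mulr_gt0.
(* In units of [c * norm1 (future w n)] the ratio for [u0] is at most 1/8 and that for [u1] at least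
   7/32; 3/16 separates them. *)
apply: (@lt_trans _ _ (c * norm1 (future w n) * (3 / 16))).
  rewrite ltr_pdivrMr //.
  by move: a v0 cf; move: (vnorm _) (vnorm _) => p q; rewrite mulrAC; nra.
rewrite ltr_pdivlMr //.
by move: b v1 cf V1; move: (vnorm _) (vnorm _) => p q; rewrite -mulrA; nra.
Qed.
End Hyperbolic.

(** * Null words occur almost surely *)

Lemma shift_base_markov k (P : 'M[R]_k) q : shift_base P q -> markov_base P q.
Proof.
case=> // -[[q0 q1] [qp PE]]; split; [split|split; [|split => //]].
- by move=> i j; rewrite PE.
- by move=> j; under eq_bigr do rewrite PE.
- by exists 1%N => i j; rewrite expr1 PE.
by move=> i; under eq_bigr do rewrite PE; rewrite -mulr_sumr q1 mulr1.
Qed.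

Lemma psum_gt0_ex (I : finType) (f : I -> R) : 0 < \sum_i f i -> exists i, 0 < f i.
Proof.
move=> H; apply: contrapT => /forallNP nf; move: H; rewrite ltNge => /negP; apply.
by apply: sumr_le0 => i _; rewrite leNgt; apply/negP/nf.
Qed.

Lemma exists_pow_lt (x eps : R) : 0 <= x < 1 -> 0 < eps -> exists n : nat, x ^+ n < eps.
Proof.
move=> /andP[x0 x1] e0; have xn : `|x| < 1 by rewrite ger0_norm.
have /cvgrPdist_lt/(_ eps e0)[n _ H] := cvg_expr xn.
exists n; have := H n (leqnn n); rewrite /= sub0r normrN ger0_norm // exprn_ge0 //.
Qed.

Section Markov.
Variables (k : nat) (P : 'M[R]_k) (q : 'I_k -> R).
Hypothesis PqP : markov_base P q.

Let P0 i j : 0 <= P i j. Proof. by case: PqP => -[]. Qed.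
Let Psum j : \sum_i P i j = 1. Proof. by case: PqP => -[]. Qed.
Let q0 i : 0 <= q i. Proof. by case: PqP => _ [_ [[]]]. Qed.
Let qsum : \sum_i q i = 1. Proof. by case: PqP => _ [_ [[]]]. Qed.

Lemma pow_gt0_path n a b : 0 < (P ^+ n) b a ->
  exists s, [/\ size s = n, path (admissible P) a s & last a s = b].
Proof.
elim: n a => [|n IH] a.
  rewrite expr0 !mxE; case: eqVneq => [->|_]; last by rewrite ltxx.
  by exists [::].
rewrite exprSr mxE => /psum_gt0_ex[c].
have [P1|] := ltP 0 (P c a); last first.
  move=> Pc; have -> : P c a = 0 by apply/eqP; rewrite eq_le Pc P0.
  by rewrite mulr0 ltxx.
rewrite pmulr_lgt0 // => /IH[s [sn ps sb]].
by exists (c :: s); split => //=; rewrite ?sn // /admissible P1.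
Qed.

(** Primitivity provides one length for all pairs, so that the blocks used below have a common
    length. *)
Lemma connecting_path : exists m, forall a b, exists s, size s = m /\
  path (admissible P) a (rcons s b).
Proof.
have [m mP] : primitive P by case: PqP => _ [].
exists m => a b.
(* One step to some [c] comes first, so that the path is nonempty even for exponent 0. *)
have [c Pc] : exists c, 0 < P c a by apply: psum_gt0_ex; rewrite Psum.
have [s [sm ps sb]] := pow_gt0_path (mP b c).
exists (belast c s); rewrite size_belast sm; split => //.
by rewrite -sb -lastI /= /admissible Pc.
Qed.

Lemma chain_mass_cat a s1 s2 :
  chain_mass P a (s1 ++ s2) = chain_mass P a s1 * chain_mass P (last a s1) s2.
Proof. by elim: s1 a => [|b s1 IH] a /=; rewrite ?mul1r // IH mulrA. Qed.

Lemma chain_mass_ge0 a s : 0 <= chain_mass P a s.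
Proof. by elim: s a => //= b s IH a; rewrite mulr_ge0. Qed.

Lemma chain_mass_gt0 a s : path (admissible P) a s -> 0 < chain_mass P a s.
Proof. by elim: s a => //= b s IH a /andP[ab /IH]; apply: mulr_gt0. Qed.

Fixpoint words n : seq (seq 'I_k) :=
  if n is n'.+1 then [seq b :: u | b <- enum 'I_k, u <- words n'] else [:: [::]].

Lemma mem_words s : s \in words (size s).
Proof.
by elim: s => //= b s IH; apply/allpairsP; exists (b, s); rewrite mem_enum.
Qed.

Lemma sum_words n a : \sum_(u <- words n) chain_mass P a u = 1.
Proof.
elim: n a => [|n IH] a /=; first by rewrite big_seq1.
rewrite big_allpairs_dep big_enum /= -[RHS](Psum a); apply: eq_bigr => b _ /=.
by rewrite -mulr_sumr IH mulr1.
Qed.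

Lemma sum_words_neq a t : \sum_(u <- words (size t) | u != t) chain_mass P a u <=
  1 - chain_mass P a t.
Proof.
rewrite -(sum_words (size t) a) [X in _ <= X - _](bigID (fun u => u == t)) /=.
rewrite lerBrDr [leLHS]addrC lerD2r (big_rem _ (mem_words t)) /= eqxx lerDl.
by apply: sumr_ge0 => *; apply: chain_mass_ge0.
Qed.

(** * Words avoiding a target word in every block *)

Section Avoid.
Variables (T : nat) (t : 'I_k -> seq 'I_k).
Hypotheses (tT : forall a, size (t a) = T) (tadm : forall a, path (admissible P) a (t a)).

(** Concatenations of [n] blocks of length [T]; the word forbidden in a block depends on the state
    just before it. *)
Fixpoint avoiding n a : seq (seq 'I_k) :=
  if n is n'.+1 then
    [seq u ++ v | u <- [seq u <- words T | u != t a], v <- avoiding n' (last a u)]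
  else [:: [::]].

(** Whatever the state before a block, its target word has positive mass, so each block multiplies
    the total mass by at most the largest of the finitely many numbers
    [1 - chain_mass P a (t a)]. *)
Lemma avoiding_mass : exists2 b : R, 0 <= b < 1 &
  forall n a, \sum_(s <- avoiding n a) chain_mass P a s <= b ^+ n.
Proof.
pose b := \big[Num.max/0]_a (1 - chain_mass P a (t a)).
have b0 : 0 <= b by apply: bigmax_ge_id.
exists b.
  rewrite b0 /=; apply: bigmax_lt => // a _.
  by have := chain_mass_gt0 (tadm a); lra.
elim=> [|n IH] a /=; first by rewrite big_seq1.
rewrite big_allpairs_dep big_filter /= exprS.
apply: (@le_trans _ _ (\sum_(u <- words T | u != t a) chain_mass P a u * b ^+ n)).
  apply: ler_sum => u _; under eq_bigr do rewrite chain_mass_cat.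
  by rewrite -mulr_sumr ler_wpM2l ?chain_mass_ge0.
rewrite -mulr_suml ler_wpM2r ?exprn_ge0 //.
rewrite -(tT a); apply: le_trans (sum_words_neq _ _) _.
exact: (le_bigmax _ (fun a => 1 - chain_mass P a (t a)) a).
Qed.

Lemma mem_avoiding (w : seqZ k) n (j : int) :
  (forall i : int, j <= i -> window w (i + 1) T != t (w i)) ->
  window w (j + 1) (n * T) \in avoiding n (w j).
Proof.
elim: n j => // n IH j H; rewrite mulSn window_cat.
have lastE : last (w j) (window w (j + 1) T) = w (j + T%:Z).
  case: T => [|m]; first by rewrite addr0.
  rewrite -addn1 window_cat last_cat /= addr0; congr w; lia.
apply/allpairsPdep; exists (window w (j + 1) T), (window w (j + 1 + T%:Z) (n * T)).
split => //.
  by rewrite mem_filter H // -{2}(size_window w (j + 1) T) mem_words.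
rewrite lastE (_ : j + 1 + T%:Z = j + T%:Z + 1); last by lia.
by apply: IH => i ij; apply: H; lia.
Qed.
End Avoid.

(** A path from [i] to [j] has to leave [i] at some step, and that transition takes positive
    probability. *)
Lemma self_transition_lt1 i j : i != j -> P i i < 1.
Proof.
move=> ij; have [m mP] := connecting_path; have [s [_]] := mP i j.
suff H : forall s, path (admissible P) i (rcons s j) -> exists2 c, c != i & 0 < P c i.
  move=> /H[c ci Pc]; rewrite -(Psum i) (bigD1 i) //= (bigD1 c) //=.
  rewrite ltrDl ltr_pwDl // sumr_ge0 //.
elim=> [|c {}s IH] /=; first by rewrite andbT => ?; exists j; rewrite // eq_sym.
have [->|ci] := eqVneq c i; first by case/andP.
by case/andP => Pc _; exists c.
Qed.

Lemma cyl_mass_nseq i n : cyl_mass P q (nseq n.+1 i) <= P i i ^+ n.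
Proof.
have qi : q i <= 1 by rewrite -qsum (bigD1 i) //= lerDl sumr_ge0.
rewrite /=; have -> : chain_mass P i (nseq n i) = P i i ^+ n.
  by elim: n => //= n ->; rewrite exprS.
by rewrite ler_piMl // exprn_ge0.
Qed.

(* [mu_null] asks for infinite covers: a finite one is completed by cylinders
   [i i ... i] of geometrically small mass *)
Lemma mu_null_finite_covers (i j : 'I_k) (N : set (seqZ k)) : i != j ->
  (forall eps : R, 0 < eps -> exists L : seq (seq 'I_k),
     N `<=` [set w | exists2 s, s \in L & cylinder 0 s w] /\
     \sum_(s <- L) cyl_mass P q s <= eps) ->
  mu_null P q N.
Proof.
move=> ij H eps eps0; have x1 := self_transition_lt1 ij.
set x := P i i in x1; have x0 : 0 <= x by apply: P0.
have e2 : 0 < eps / 2 by lra.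
have [L [NL Lmass]] := H _ e2.
have ee : 0 < eps / 2 * (1 - x) by rewrite mulr_gt0 //; lra.
(* From exponent [K] on, the geometric series of [x] sums to less than [eps / 2]. *)
have [K xK] : exists K : nat, x ^+ K < eps / 2 * (1 - x).
  by apply: exists_pow_lt => //; rewrite x0.
exists (fun l => (0, nth (nseq (K + l).+1 i) L l)); split.
  move=> w /NL[s sL ws]; exists (index s L) => //=.
  by rewrite nth_index.
move=> M /=.
have cyl0 s : 0 <= cyl_mass P q s.
  by case: s => //= a s; rewrite mulr_ge0 ?chain_mass_ge0.
apply: (@le_trans _ _ (\sum_(s <- L) cyl_mass P q s + \sum_(l < M) x ^+ (K + l))).
  (* [K] is generalised because removing the head of [L] shifts the exponents by one. *)
  elim: L M {NL Lmass H} K {xK} => [|s L IH] M K.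
    by rewrite big_nil add0r; apply: ler_sum => l _; rewrite nth_nil cyl_mass_nseq.
  case: M => [|M]; first by rewrite !big_ord0 addr0 sumr_ge0.
  rewrite !big_ord_recl big_cons /= -!addrA lerD2l.
  apply: le_trans (_ : \sum_(i0 < M) cyl_mass P q (nth (nseq (K.+1 + i0).+1 i) L i0) <= _).
    by apply: ler_sum => l _; rewrite /bump /= add1n addnS ?addSn.
  apply: le_trans (IH M K.+1) _; rewrite lerD2l.
  rewrite ler_wpDl ?exprn_ge0 //; apply: ler_sum => l _.
  by rewrite /bump /= add1n addnS ?addSn.
rewrite [leRHS](_ : _ = eps / 2 + eps / 2); last by lra.
apply: lerD => //.
under eq_bigr do rewrite exprD.
rewrite -mulr_sumr -(ler_pM2r (_ : 0 < 1 - x)); last by lra.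
apply: le_trans (ltW xK); rewrite -mulrA ler_piMr ?exprn_ge0 //.
have := subrX1 x M; have := exprn_ge0 M x0; lra.
Qed.

Lemma L1_minfty_of_zero (A : 'I_k -> 'M[R]_2) (N : set (seqZ k)) : mu_null P q N ->
  (forall w, inX P w -> ~ N w -> exists n, wprod A (window w 1 n) = 0) ->
  L1_is_minfty P q A.
Proof.
move=> N0 H; exists N; split => // w wX Nw; have [n wn] := H w wX Nw.
have o0 : opnorm 0 = 0.
  rewrite /opnorm (_ : [set _ | _ in _] = [set 0]) ?sup1 //.
  apply/seteqP; split => [_ [v _ <-]|_ ->].
    by rewrite /= mul0mx /vnorm !mxE expr0n addr0 sqrtr0.
  exists (delta_mx 0 0); first by rewrite /= /vnorm !mxE /= expr1n expr0n addr0 sqrtr1.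
  by rewrite mul0mx /vnorm !mxE expr0n addr0 sqrtr0.
(* From [n] on the product is zero; starting at [n.+1] also makes [m] positive, hence the factor in
   front of [-oo] too. *)
apply: cvg_near_cst; exists n.+1 => // m /= nm.
rewrite Aiter_wprod.
have -> : wprod A (window w 1 m) = 0.
  by rewrite -(subnKC (ltnW nm)) window_cat wprod_cat wn mulmx0.
rewrite o0 /logE eqxx gt0_muleNy // lte_fin invr_gt0 ltr0n.
exact: leq_trans nm.
Qed.

(** From any state a path of fixed length leads to [a] and on through [s]. The sequences avoiding
    these words in all blocks have arbitrarily small mass, and after one such word the product stays
    zero. *)
Lemma null_word_L1 (A : 'I_k -> 'M[R]_2) (i j : 'I_k) a s : i != j ->
  path (admissible P) a s -> wprod A (a :: s) = 0 -> L1_is_minfty P q A.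
Proof.
move=> ij pas was; have [m mP] := connecting_path.
have /(@boolp.choice _ _ _)[u uP] := fun b => mP b a.
pose t b := rcons (u b) a ++ s; pose T := (m.+1 + size s)%N.
have tT b : size (t b) = T by rewrite size_cat size_rcons (uP b).1.
have tadm b : path (admissible P) b (t b).
  by rewrite cat_path (uP b).2 last_rcons.
have wt b : wprod A (t b) = 0.
  rewrite /t cat_rcons wprod_cat was mul0mx //.
pose N := [set w | forall m, wprod A (window w 1 m) <> 0].
apply: (@L1_minfty_of_zero A N); last first.
  by move=> w _ /existsNP[n /contrapT wn]; exists n.
have [b b01 bP] := avoiding_mass tT tadm.
apply: (mu_null_finite_covers ij) => eps eps0.
have [n bn] := exists_pow_lt b01 eps0.
exists [seq c :: v | c <- enum 'I_k, v <- avoiding T t n c]; split.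
  move=> w Nw; exists (w 0 :: window w (0 + 1) (n * T)).
    apply/allpairsPdep; exists (w 0), (window w (0 + 1) (n * T)).
    rewrite mem_enum; split => //; apply: mem_avoiding => c c0.
    apply/eqP => E; have [d cd] : exists d : nat, c = d%:Z by exists `|c|%N; lia.
    apply: (Nw (d + T)%N); rewrite window_cat wprod_cat.
    by rewrite (_ : 1 + d%:Z = c + 1) ?E ?wt ?mul0mx // cd addrC.
  rewrite -windowS => l; rewrite size_window => lT.
  by rewrite (nth_map 0%N) ?size_iota // nth_iota.
rewrite big_allpairs_dep big_enum /=; apply: le_trans (ltW bn).
apply: (@le_trans _ _ (\sum_c q c * b ^+ n)); last by rewrite -mulr_suml qsum mul1r.
by apply: ler_sum => c _; rewrite -mulr_sumr ler_wpM2l.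
Qed.
End Markov.

(** * Dichotomy *)

Lemma no_null_word_hyperbolic (k : nat) (P : 'M[R]_k) (q : 'I_k -> R)
  (A : 'I_k -> 'M[R]_2) (e : R) :
  markov_base P q -> (forall i, 0 <= \det (A i)) -> (exists i, \det (A i) = 0) ->
  0 < e -> no_null_word (admissible P) A e -> proj_unif_hyperbolic P A.
Proof.
move=> PqP dA sing e0 nn.
have [m mP] := connecting_path PqP.
have conn a b : exists s, path (admissible P) a (rcons s b).
  by have [s [_ ps]] := mP a b; exists s.
pose e' := Num.min e 1.
have e'0 : 0 < e' by rewrite lt_min e0 ltr01.
have e'1 : e' <= 1 by rewrite ge_min lexx orbT.
have nn' : no_null_word (admissible P) A e'.
  by move=> t te; apply: nn; apply: lt_le_trans te _; rewrite ge_min lexx.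
have [v [r rob]] := exists_robust_frame e'0 dA sing conn nn'.
have c0 : 0 < (e' ^+ 2 / 96) ^+ 2 by rewrite exprn_gt0 // divr_gt0 // exprn_gt0.
have K0 : 0 <= 32 / (e' ^+ 2 * (e' ^+ 2 / 96) ^+ 4) + 1.
  by rewrite addr_ge0 // divr_ge0 // mulr_ge0 ?exprn_ge0 // ?divr_ge0 ?exprn_ge0 // ltW.
apply: (projective_uniform_hyperbolicity c0 K0 dA).
- by move=> a s; apply: det_decay rob _ _ dA.
- by move=> a s1 s2; apply: quasi_multiplicative rob _ _ _.
Qed.

Theorem theorem1p1 (k : nat) (P : 'M[R]_k) (q : 'I_k -> R)
  (A : 'I_k -> 'M[R]_2) :
  shift_base P q ->
  (forall i, 0 <= \det (A i)) ->
  (exists i, \det (A i) = 0) ->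
  (exists j, \det (A j) != 0) ->
  proj_unif_hyperbolic P A \/
  exists An : nat -> 'I_k -> 'M[R]_2,
    (forall n i, 0 <= \det (An n i)) /\
    (forall i (a b : 'I_2), (fun n => An n i a b) @ \oo --> A i a b) /\
    (forall n, L1_is_minfty P q (An n)).
Proof.
move=> /shift_base_markov PqP dA sing [j dj].
have [[e [e0 nn]]|H] := pselect (exists e : R, 0 < e /\ no_null_word (admissible P) A e).
  by left; apply: no_null_word_hyperbolic PqP dA sing e0 nn.
right; have [i di] := sing.
(* The singular and the invertible letter supply the two distinct letters that [null_word_L1] asks
   for. *)
have ij : i != j by apply: contraNneq dj => <-; apply/eqP.
(* The failure of [no_null_word] at radius [n.+1%:R^-1] supplies the n-th parameter together with
   its null word. *)
have : forall n : nat, exists t : R, `|t| < n.+1%:R^-1 /\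
    exists a s, path (admissible P) a s /\ wprod (fun b => A b *m rot t) (a :: s) = 0.
  move=> n; apply: contrapT => Hn; apply: H; exists n.+1%:R^-1; split=> //.
  move=> t te a s ps; apply/eqP => E; apply: Hn; exists t; split => //.
  by exists a, s.
move=> /(@boolp.choice _ _ _)[t tP].
exists (fun n b => A b *m rot (t n)); split; [|split].
- move=> n b; rewrite det_mulmx mulr_ge0 // det2E !mxE /=.
  by have := sqr_ge0 (t n); lra.
- move=> b c d.
  have E x : (A b *m rot x) c d = A b c d + x * (A b *m J R) c d.
    by rewrite rotJ mulmxDr mulmx1 -scalemxAr !mxE.
  under eq_fun do rewrite E.
  exact: (@cvg_add_vanishing R (A b c d) ((A b *m J R) c d) t (fun n => (tP n).1)).
move=> n; have [_ [a [s [ps was]]]] := tP n.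
exact: null_word_L1 PqP _ _ _ _ _ ij ps was.
Qed.
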